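(* Let $K\subseteq\mathbb{R}^n$ be a convex body and let $\Lambda\subseteq\mathbb{R}^n$ be an $n$-dimensional lattice. Then $$\frac{1}{n!}\prod_{i=1}^n\frac{1}{\rho_i(K,\Lambda)}\le\frac{\mathrm{vol}(K)}{\det(\Lambda)}\le\prod_{i=1}^n\frac{1}{\rho_i(K,\Lambda)}.$$
   Context: A convex body in $\mathbb{R}^n$ is a compact convex set with non-empty interior. An $n$-dimensional lattice is a set $\Lambda=B\mathbb{Z}^n$ with $B\in\mathbb{R}^{n\times n}$ invertible, and $\det(\Lambda)=|\det B|$. $\mathrm{vol}$ is $n$-dimensional Lebesgue measure. $K_c=K-K=\{x-y:x,y\in K\}$ is the difference body. Packing minima: for $1\le i\le n$, $\rho_i(K,\Lambda)=\inf\{\rho>0:(\rho K_c+L)\cap\Lambda\neq L\cap\Lambda\text{ for all }(n-i)\text{-dimensional linear subspaces }L\subseteq\mathbb{R}^n\}$. Equivalently, $\rho_i(K,\Lambda)=\max\lambda_1(K_c|L^\perp,\Lambda|L^\perp)$, the maximum over all $(n-i)$-dimensional linear lattice planes $L$ of $\Lambda$ (linear subspaces $L$ with $\dim L=\dim(L\cap\Lambda)=n-i$), where $\cdot|L^\perp$ is orthogonal projection onto $L^\perp$ and, for an origin-symmetric convex body $M$ and a lattice $\Gamma$ in the same Euclidean space, $\lambda_1(M,\Gamma)=\min\{\lambda>0:\lambda M\cap\Gamma\ne\{0\}\}$. *)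

(* Defs.v *)
From HB Require Import structures.
From mathcomp Require Import all_boot all_order all_algebra.
From mathcomp Require Import all_classical all_reals all_analysis.

Set Implicit Arguments.
Unset Strict Implicit.
Unset Printing Implicit Defensive.

Import Order.TTheory GRing.Theory Num.Theory.
Import numFieldNormedType.Exports.

Local Open Scope classical_set_scope.
Local Open Scope ring_scope.

(* The SigmaFiniteMeasure instance the library declares for m1 \x m2 is shadowed
   by the one for products of (sub)probabilities, whence this alias. *)
Section sigma_finite_product.
Context d1 d2 (T1 : measurableType d1) (T2 : measurableType d2) (R : realType).
Variable m1 : {sigma_finite_measure set T1 -> \bar R}.
Variable m2 : {sigma_finite_measure set T2 -> \bar R}.

Definition sigma_finite_product : set (T1 * T2) -> \bar R := (m1 \x m2)%E.

HB.instance Definition _ := Measure.on sigma_finite_product.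

Let sigma_finite_product_setT : sigma_finite setT sigma_finite_product.
Proof.
have /sigma_finiteP[F [TF ndF Foo]] := sigma_finiteT m1.
have /sigma_finiteP[G [TG ndG Goo]] := sigma_finiteT m2.
exists (fun n => F n `*` G n).
  rewrite -setXTT TF TG predeqE => -[x y]; split.
    move=> [/= [n _ Fnx] [k _ Gky]]; exists (maxn n k) => //; split.
    - by move: x Fnx; exact/subsetPset/ndF/leq_maxl.
    - by move: y Gky; exact/subsetPset/ndG/leq_maxr.
  by move=> [n _ []/= ? ?]; split; exists n.
move=> k; have [? ?] := Foo k; have [? ?] := Goo k.
split; first exact: measurableX.
rewrite /sigma_finite_product product_measure1E// lte_mul_pinfty//.
by rewrite ge0_fin_numE.
Qed.

HB.instance Definition _ := Measure_isSigmaFinite.Build _ _ _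
  sigma_finite_product sigma_finite_product_setT.

End sigma_finite_product.

(* R^n is 'cV[R]_n.  The library has no n-dimensional Lebesgue measure, so it
   is built as the n-fold product of lebesgue_measure, on the iterated product
   R * (R * ( ... * unit)), the one-point space unit having mass 1. *)
Section lebesgue_measure_Rn.
Variable R : realType.

Definition unit_mass : set unit -> \bar R := \d_tt.

HB.instance Definition _ := Measure.on unit_mass.

Let unit_mass_setT : unit_mass setT = 1%E.
Proof. exact: diracT. Qed.

HB.instance Definition _ :=
  Measure_isProbability.Build _ _ R unit_mass unit_mass_setT.

Fixpoint Rn_display (n : nat) : measure_display :=
  if n is m.+1 then
    ((R.-ocitv.-measurable.-sigma, Rn_display m).-prod)%mdisp
  else default_measure_display.

Fixpoint Rn (n : nat) : measurableType (Rn_display n) :=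
  if n is m.+1 then (measurableTypeR R * Rn m)%type : measurableType _
  else unit : measurableType _.

Fixpoint lebesgue_measure_Rn (n : nat) :
    {sigma_finite_measure set (Rn n) -> \bar R} :=
  match n return {sigma_finite_measure set (Rn n) -> \bar R} with
  | 0 => unit_mass : {sigma_finite_measure set unit -> \bar R}
  | m.+1 => sigma_finite_product
      (@lebesgue_measure R :
         {sigma_finite_measure set (measurableTypeR R) -> \bar R})
      (lebesgue_measure_Rn m)
  end.

Fixpoint Rn_col (n : nat) : Rn n -> 'cV[R]_n :=
  match n with
  | 0 => fun=> 0
  | m.+1 => fun x => col_mx (const_mx x.1 : 'cV_1) (Rn_col x.2)
  end.

Definition vol (n : nat) (A : set 'cV[R]_n) : \bar R :=
  lebesgue_measure_Rn n (@Rn_col n @^-1` A).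

End lebesgue_measure_Rn.

Section lattices_and_bodies.
Variables (R : realType) (n : nat).
Implicit Types (A K L Lambda : set 'cV[R]_n) (B : 'M[R]_n).

Definition convex_body K : Prop :=
  [/\ compact K, @convex_set R 'cV[R]_n K & interior K !=set0].

Definition lattice B : set 'cV[R]_n :=
  [set B *m map_mx intr z | z in [set: 'cV[int]_n]].

Definition lattice_det B : R := `|\det B|.

Definition difference_body K : set 'cV[R]_n := [set x - y | x in K & y in K].

Definition dilate (r : R) A : set 'cV[R]_n := [set r *: x | x in A].

Definition minkowski_sum A A' : set 'cV[R]_n := [set x + y | x in A & y in A'].

Definition packing_minimum K Lambda (i : nat) : R :=
  inf [set r : R | 0 < r /\
    forall L : {vspace 'cV[R]_n}, \dim L = (n - i)%N ->
      minkowski_sum (dilate r (difference_body K)) [set` L] `&` Lambda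
        <> [set` L] `&` Lambda].

End lattices_and_bodies.

(* Main.v *)
Require Import Defs.
From mathcomp Require Import all_boot all_order all_algebra.
From mathcomp Require Import all_classical all_reals all_analysis.
From mathcomp Require Import measurable_realfun unstable.
From mathcomp Require Import lra ring zify.

Set Implicit Arguments.
Unset Strict Implicit.
Unset Printing Implicit Defensive.

Import Order.TTheory GRing.Theory Num.Theory.
Import numFieldNormedType.Exports.

Local Open Scope classical_set_scope.
Local Open Scope ring_scope.

(* Both bounds are reduced to [Z^n] by a linear change of variables; write
   [rho_i] for the packing minima and [K_c = K - K].

   Lower bound, by induction on [n]. For [r > rho_n] some nonzero lattice point
   lies in [r K_c]; a unimodular map sends it to a multiple of [e_1], so [K]
   contains a chord of length [1 / r] in direction [e_1]. Comparing fibres with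
   those of a cone over the projection [P] of [K] along [e_1] gives
   [vol K >= vol P / (n r)], and [rho_i P <= rho_i K] for [i < n].

   Upper bound. Fix [t < 1] and let [r_k] be [t] times the largest of
   [rho_n, ..., rho_(n - k + 1)]. The lattice points of [r_k K_c] span a space
   of dimension [< k], so after a unimodular map they lie in the span of
   [e_1, ..., e_(k - 1)]. Choose [c_k x] in the fibre of [K] over the last
   [n - k + 1] coordinates of [x], as a function of those coordinates. The map
   [x |-> r_1 x + (r_2 - r_1) c_2 x + ... + (r_n - r_(n - 1)) c_n x] is
   triangular and multiplies the volume by [r_1 * ... * r_n]. If two points of
   its image of [K] differ by a lattice vector whose last nonzero coordinate is
   the [k]-th, that vector lies in [r_k K_c], which is impossible; hence the
   image has volume at most [1]. *)

(** * Maps multiplying a measure by a constant *)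

Section measure_scaling.
Context d (T : measurableType d) (R : realType).
Variable mu : {measure set T -> \bar R}.

(** The measure is taken of preimages, so an invertible matrix [M] scales by [|det M|^-1], and
    factors multiply under composition. *)
Definition scales (c : R) (f : T -> T) :=
  measurable_fun setT f /\
  forall A, measurable A -> mu (f @^-1` A) = (c%:E * mu A)%E.

Lemma scales_comp c1 c2 f1 f2 : scales c1 f1 -> scales c2 f2 ->
  scales (c1 * c2) (f2 \o f1).
Proof.
move=> [mf1 sf1] [mf2 sf2]; split; first exact: measurableT_comp.
move=> A mA; rewrite comp_preimage sf1; last first.
  by rewrite -[X in measurable X]setTI; exact: mf2.
by rewrite sf2// muleA EFinM.
Qed.

Lemma scales_id : scales 1 id.
Proof. by split=> // A mA; rewrite preimage_id mul1e. Qed.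

(** The pushforward of [mu] under [f] is [c] times [mu]. *)
Lemma scales_integral (c : R) f (h : T -> \bar R) : 0 <= c -> scales c f ->
  measurable_fun setT h -> (forall x, 0 <= h x)%E ->
  (\int[mu]_x h (f x) = c%:E * \int[mu]_x h x)%E.
Proof.
move=> c0 [mf sf] mh h0.
have := @ge0_integral_pushforward _ _ _ _ R f mf mu setT h measurableT mh
  (fun y _ => h0 y).
rewrite preimage_setT => <-.
rewrite -[c]/(NngNum c0)%:num.
rewrite -(@ge0_integral_mscale _ _ R mu setT measurableT (NngNum c0) h)//.
apply: eq_measure_integral => A mA _.
exact: sf.
Qed.

End measure_scaling.

Section affine_line.
Context (R : realType).
Notation mu := (@lebesgue_measure R).

Lemma measurable_affine (a b : R) :
  measurable_fun [set: R] (fun t : R => a * t + b).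
Proof. by apply: measurable_funD => //; exact: measurable_funM. Qed.

(** By uniqueness of Lebesgue measure, it suffices to compare it on intervals []x, y]] with [|a|]
    times its pushforward under the affine map. *)
Lemma lebesgue_measure_affine (a b : R) (A : set (measurableTypeR R)) :
  a != 0 -> measurable A ->
  mu [set t | A (a * t + b)] = (`|a|^-1%:E * mu A)%E.
Proof.
move=> a0 mA.
have mf := measurable_affine a b.
have an : 0 <= `|a| by [].
have a0' : `|a| != 0 by rewrite normr_eq0.
pose T : measurableTypeR R -> measurableTypeR R := fun t : R => a * t + b.
pose nu : {measure set (measurableTypeR R) -> \bar R} :=
  mscale (NngNum an) (measure_function_pushforward__canonical__measure_function_Measure mu (mf : measurable_fun setT T)).
have nuE X : nu X = (`|a|%:E * mu (T @^-1` X))%E by [].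
suff -> : mu A = nu A by rewrite nuE muleA -EFinM mulVf// mul1e.
apply: lebesgue_measure_unique mA => _ [[x y] _ <-]; rewrite nuE.
case: (ltP a 0) => ha.
  (* A negative slope swaps the ends: the preimage of []x, y]] is closed on the left and open on the
     right. *)
  rewrite [X in (_ * mu X)%E](_ : _ = [set` `[(y - b) / a, (x - b) / a[]); last first.
    rewrite /T; apply/seteqP; split => t /=; rewrite !in_itv/=;
      rewrite ler_ndivrMr// ltr_ndivlMr// mulrC => /andP[? ?];
      apply/andP; split; lra.
  rewrite (ltr0_norm ha) lebesgue_measure_itv/= lebesgue_measure_itv/= !lte_fin.
  rewrite ltr_ndivrMr// divfK ?lt_eqF// ltrD2r.
  case: ifP => xy; last by rewrite mule0.
  by rewrite -EFinB -EFinM; congr EFin; field.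
have {}ha : 0 < a by rewrite lt_def a0.
rewrite [X in (_ * mu X)%E](_ : _ = [set` `](x - b) / a, (y - b) / a]]); last first.
  rewrite /T; apply/seteqP; split => t /=; rewrite !in_itv/=;
    rewrite ltr_pdivrMr// ler_pdivlMr// mulrC => /andP[? ?];
    apply/andP; split; lra.
rewrite (gtr0_norm ha) lebesgue_measure_itv/= lebesgue_measure_itv/= !lte_fin.
rewrite ltr_pdivrMr// divfK// ltrD2r.
case: ifP => xy; last by rewrite mule0.
by rewrite -EFinB -EFinM; congr EFin; field.
Qed.

End affine_line.

Section Rn.
Context (R : realType).
Notation mu n := (lebesgue_measure_Rn R n : {measure set (Rn R n) -> \bar R}).

(** The definition slices at a fixed first coordinate; slicing at a fixed tail gives the same
    measure by uniqueness of the product measure. *)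
Lemma lebesgue_measure_RnS2 n (A : set (Rn R n.+1)) : measurable A ->
  mu n.+1 A = (\int[mu n]_y @lebesgue_measure R (ysection A y))%E.
Proof.
move=> mA; apply: (@product_measure_unique _ _ _ _ R _ _
  (product_measure2 (@lebesgue_measure R) (lebesgue_measure_Rn R n))) => // B C mB mC.
exact: product_measure2E.
Qed.

Lemma lebesgue_measure_RnS1 n (A : set (Rn R n.+1)) : measurable A ->
  mu n.+1 A = (\int[@lebesgue_measure R]_t mu n (xsection A t))%E.
Proof. by []. Qed.

(** Over a fixed tail the head moves by an affine map of slope [a]; integrating over the tails then
    brings in the factor [c]. The offset [g] is only assumed measurable, which is the regularity
    that [top] provides. *)
Lemma scales_triangular n (a c : R) (g : Rn R n -> R) f :
  a != 0 -> 0 <= c -> measurable_fun setT g -> scales (mu n) c f ->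
  scales (mu n.+1) (`|a|^-1 * c)
    (fun x : Rn R n.+1 => (a * x.1 + g x.2, f x.2) : Rn R n.+1).
Proof.
move=> a0 c0 mg [mf sf].
have mT : measurable_fun setT
    (fun x : Rn R n.+1 => (a * x.1 + g x.2, f x.2) : Rn R n.+1).
  apply: measurable_fun_pair => /=; last exact: measurableT_comp.
  apply: measurable_funD; last exact: measurableT_comp.
  by apply: measurable_funM => //; exact: measurable_fst.
split=> // A mA.
rewrite lebesgue_measure_RnS2; last by rewrite -[X in measurable X]setTI; exact: mT.
rewrite (eq_integral (fun y => `|a|^-1%:E * 
    (@lebesgue_measure R (ysection A (f y)))))%E; last first.
  move=> y _.
  have mAy : measurable (ysection A (f y)) by exact: measurable_ysection.
  rewrite -(lebesgue_measure_affine (g y) a0 mAy).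
  by [].
have mh := @measurable_fun_ysection _ _ _ _ R (@lebesgue_measure R) A mA.
rewrite ge0_integralZl//.
- rewrite (scales_integral c0 (conj mf sf) mh) => [|y//].
  by rewrite muleA -EFinM -lebesgue_measure_RnS2.
- by apply: (measurableT_comp mh).
Qed.

(** The opposite triangular shape: at each fixed head, the tail moves by a measure-preserving
    map. *)
Lemma scales_shear n (f : R -> Rn R n -> Rn R n) :
  measurable_fun setT (fun x : Rn R n.+1 => f x.1 x.2) ->
  (forall t, scales (mu n) 1 (f t)) ->
  scales (mu n.+1) 1 (fun x : Rn R n.+1 => (x.1, f x.1 x.2) : Rn R n.+1).
Proof.
move=> mf sf.
have mT : measurable_fun setT
    (fun x : Rn R n.+1 => (x.1, f x.1 x.2) : Rn R n.+1).
  by apply: measurable_fun_pair => //=; exact: measurable_fst.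
split=> // A mA.
rewrite lebesgue_measure_RnS1; last first.
  by rewrite -[X in measurable X]setTI; exact: mT.
rewrite mul1e lebesgue_measure_RnS1//; apply: eq_integral => t _.
have mAt : measurable (xsection A t) by exact: measurable_xsection.
by rewrite -[RHS]mul1e -((sf t).2 _ mAt).
Qed.

End Rn.

(** * Linear changes of variables in R^n *)

Section head_tail.
Context (R : nzRingType) (n : nat).
Implicit Types (t : R) (y : 'cV[R]_n) (x : 'cV[R]_n.+1).

Definition vcons t y : 'cV[R]_n.+1 := col_mx (const_mx t : 'cV_1) y.
Definition vtail x : 'cV[R]_n := dsubmx (x : 'cV_(1 + n)).

Lemma vcons0 t y : vcons t y 0 0 = t.
Proof. by rewrite /vcons mxE; case: splitP => // k _; rewrite mxE. Qed.

Lemma vconsS t y i : vcons t y (lift 0 i) 0 = y i 0.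
Proof.
rewrite /vcons mxE; case: splitP => [[[]]//|k /= [ik]].
by congr (y _ 0); apply: val_inj.
Qed.

Lemma vtailE x i : vtail x i 0 = x (lift 0 i) 0.
Proof. by rewrite /vtail mxE; congr (x _ 0); exact: val_inj. Qed.

Lemma vconsK t y : vtail (vcons t y) = y.
Proof. exact: col_mxKd. Qed.

Lemma vcons_eta x : vcons (x 0 0) (vtail x) = x.
Proof.
apply/matrixP => i j; rewrite (ord1 j).
by case: (unliftP 0 i) => [k|] ->; rewrite ?vcons0// vconsS vtailE.
Qed.

Lemma vtailD x x' : vtail (x + x') = vtail x + vtail x'.
Proof. by apply/colP => i; rewrite !(vtailE, mxE). Qed.

Lemma vtailB x x' : vtail (x - x') = vtail x - vtail x'.
Proof. by apply/colP => i; rewrite !(vtailE, mxE). Qed.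

Lemma vtailZ t x : vtail (t *: x) = t *: vtail x.
Proof. by apply/colP => i; rewrite !(vtailE, mxE). Qed.

Lemma vtail0 : vtail 0 = 0.
Proof. by apply/colP => i; rewrite vtailE !mxE. Qed.

Lemma vcons_inj t t' y y' : vcons t y = vcons t' y' -> t = t' /\ y = y'.
Proof.
move=> e; split; first by rewrite -(vcons0 t y) e vcons0.
by rewrite -(vconsK t y) e vconsK.
Qed.

Lemma vconsD t t' y y' : vcons t y + vcons t' y' = vcons (t + t') (y + y').
Proof.
apply/colP => i; rewrite mxE.
by case: (unliftP 0 i) => [k|] ->; rewrite ?vcons0// !vconsS mxE.
Qed.

Lemma vconsZ a t y : a *: vcons t y = vcons (a * t) (a *: y).
Proof.
apply/colP => i; rewrite mxE.
by case: (unliftP 0 i) => [k|] ->; rewrite ?vcons0// !vconsS mxE.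
Qed.

Lemma vcons_sum (I : finType) (f : I -> R) (g : I -> 'cV[R]_n) :
  \sum_i vcons (f i) (g i) = vcons (\sum_i f i) (\sum_i g i).
Proof.
elim/big_rec3: _ => [|i x y z _ ->]; last by rewrite vconsD.
by apply/colP => i; rewrite mxE; case: (unliftP 0 i) => [k|] ->;
  rewrite ?vcons0// !vconsS mxE.
Qed.

End head_tail.

Lemma mul_block_vcons (R : comNzRingType) n (a : R) (w : 'rV_n) (v : 'cV_n) (S : 'M[R]_n) (x : 'cV[R]_n.+1) :
  (block_mx a%:M w v S : 'M[R]_(1 + n)) *m x =
  vcons (a * x 0 0 + (w *m vtail x) 0 0) (S *m vtail x + x 0 0 *: v).
Proof.
rewrite -{1}(vcons_eta x) /vcons mul_block_col.
rewrite mul_scalar_mx addrC [S *m _ + _]addrC; congr col_mx.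
  by apply/matrixP => i j; rewrite !ord1 !mxE addrC.
congr (_ + _).
by apply/matrixP => i j; rewrite (ord1 j) !mxE big_ord1 !mxE mulrC.
Qed.

Section Rn_coordinates.
Context (R : realType).
Notation mu n := (lebesgue_measure_Rn R n : {measure set (Rn R n) -> \bar R}).

Lemma Rn_colS n (x : Rn R n.+1) : Rn_col x = vcons x.1 (Rn_col x.2).
Proof. by []. Qed.

Fixpoint col_Rn n : 'cV[R]_n -> Rn R n :=
  match n with
  | 0 => fun=> tt
  | m.+1 => fun x => (x 0 0, col_Rn (vtail x))
  end.

Lemma Rn_colK n : cancel (@Rn_col R n) (@col_Rn n).
Proof.
by elim: n => [[]//|n IH [t y]] /=; rewrite -/(vcons t (Rn_col y)) vcons0 vconsK IH.
Qed.

Lemma col_RnK n : cancel (@col_Rn n) (@Rn_col R n).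
Proof.
elim: n => [x|n IH x] /=; first by apply/colP => -[].
by rewrite IH -[RHS]vcons_eta.
Qed.

Lemma measurable_coord n (i : 'I_n) :
  measurable_fun setT (fun x : Rn R n => Rn_col x i 0).
Proof.
elim: n i => [[]//|n IH i]; case: (unliftP 0 i) => [k|] ->.
  rewrite (_ : (fun _ => _) = (fun y : Rn R n => Rn_col y k 0) \o snd).
    by apply: measurableT_comp => //; exact: measurable_snd.
  by apply/funext => x; rewrite Rn_colS vconsS.
rewrite (_ : (fun _ => _) = fst); first exact: measurable_fst.
by apply/funext => x; rewrite Rn_colS vcons0.
Qed.

Lemma measurable_fun_Rn d (T : measurableType d) n (f : T -> Rn R n) :
  (forall i, measurable_fun setT (fun x => Rn_col (f x) i 0)) ->
  measurable_fun setT f.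
Proof.
elim: n f => [f _|n IH f mf].
  rewrite (_ : f = cst tt) //; by apply/funext => x; case: (f x).
rewrite (_ : f = fun x => ((f x).1, (f x).2)); last first.
  by apply/funext => x; case: (f x).
apply: measurable_fun_pair.
  have := mf 0; congr (measurable_fun setT).
  by apply/funext => x; rewrite Rn_colS vcons0.
apply: IH => i; have := mf (lift 0 i); congr (measurable_fun setT).
by apply/funext => x; rewrite Rn_colS vconsS.
Qed.

Definition vmeasurable n (A : set 'cV[R]_n) := measurable (@Rn_col R n @^-1` A).

Definition on_Rn n (T : 'cV[R]_n -> 'cV[R]_n) (x : Rn R n) : Rn R n :=
  col_Rn (T (Rn_col x)).

Definition vscales n c (T : 'cV[R]_n -> 'cV[R]_n) := scales (mu n) c (on_Rn T).

Lemma vscalesE n c (T : 'cV[R]_n -> 'cV[R]_n) A : vscales c T ->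
  vmeasurable A -> vmeasurable (T @^-1` A) /\ vol (T @^-1` A) = (c%:E * vol A)%E.
Proof.
move=> [mT sT] mA.
have e : Rn_col (n:=n) @^-1` (T @^-1` A) = on_Rn T @^-1` (Rn_col (n:=n) @^-1` A).
  by apply/seteqP; split => x /=; rewrite /on_Rn col_RnK.
split; last by rewrite /vol e; exact: sT.
by rewrite /vmeasurable e -[X in measurable X]setTI; exact: mT.
Qed.

Lemma vscales_comp n c1 c2 (T1 T2 : 'cV[R]_n -> 'cV[R]_n) :
  vscales c1 T1 -> vscales c2 T2 -> vscales (c1 * c2) (T2 \o T1).
Proof.
move=> s1 s2; rewrite /vscales (_ : on_Rn _ = on_Rn T2 \o on_Rn T1).
  exact: scales_comp.
by apply/funext => x; rewrite /on_Rn/= col_RnK.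
Qed.

Lemma measurable_lin n (w : 'rV[R]_n) :
  measurable_fun setT (fun x : Rn R n => (w *m Rn_col x) 0 0).
Proof.
under eq_fun do rewrite mxE.
apply: measurable_sum => i; apply: measurable_funM => //.
exact: measurable_coord.
Qed.

Lemma vscales_triangular n (a c : R) (g : 'cV[R]_n -> R) T :
  a != 0 -> 0 <= c -> measurable_fun setT (fun x : Rn R n => g (Rn_col x)) ->
  vscales c T ->
  vscales (`|a|^-1 * c) (fun x => vcons (a * x 0 0 + g (vtail x)) (T (vtail x))).
Proof.
move=> a0 c0 mg sT; have := scales_triangular a0 c0 mg sT.
congr (scales _ _); apply/funext => x.
by rewrite /on_Rn Rn_colS /= vcons0 !vconsK vcons0.
Qed.

Lemma vscales_translate n (v : 'cV[R]_n) : vscales 1 (fun x => x + v).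
Proof.
elim: n v => [v|n IH v].
  rewrite /vscales (_ : on_Rn _ = id); first exact: scales_id.
  by apply/funext => -[].
have := @vscales_triangular _ 1 1 (fun=> v 0 0) _ (oner_neq0 _) ler01
  (measurable_cst _) (IH (vtail v)).
rewrite normr1 invr1 mul1r; congr (vscales _); apply/funext => x.
by rewrite mul1r -vconsD !vcons_eta.
Qed.

Lemma vscales_shear n (v : 'cV[R]_n) :
  vscales 1 (fun x => vcons (x 0 0) (vtail x + x 0 0 *: v)).
Proof.
have := @scales_shear R n (fun t => on_Rn (fun y => y + t *: v)).
have s t : scales (mu n) 1 (on_Rn (fun y => y + t *: v)) by exact: vscales_translate.
move=> /(_ _ s); rewrite /vscales (_ : on_Rn _ =
    (fun x : Rn R n.+1 => (x.1, on_Rn (fun y => y + x.1 *: v) x.2) : Rn R n.+1)).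
  apply; apply: measurable_fun_Rn => i.
  under eq_fun do rewrite col_RnK !mxE.
  apply: measurable_funD; last first.
    by apply: measurable_funM => //; exact: measurable_fst.
  by apply: (measurableT_comp (measurable_coord i)); exact: measurable_snd.
by apply/funext => x; rewrite /on_Rn/= vconsK -/(vcons x.1 (Rn_col x.2)) !vcons0 vconsK.
Qed.

(** Induction by block elimination. With a nonzero corner entry, the matrix is a lower shear times a
    block upper triangular matrix whose lower right block is the Schur complement [S]. A zero corner
    is first repaired by a column operation. *)
Lemma vscales_mulmx n (M : 'M[R]_n) : M \in unitmx ->
  vscales (`|\det M|^-1) (mulmx M).
Proof.
elim: n M => [M _|n IH M].
  rewrite det_mx00 normr1 invr1 /vscales (_ : on_Rn _ = id); first exact: scales_id.
  by apply/funext => -[].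
have shear (v : 'cV_n) : vscales 1 (mulmx (block_mx 1%:M 0 v 1%:M : 'M[R]_(1 + n))).
  have := vscales_shear v; congr vscales; apply/funext => x.
  by rewrite mul_block_vcons !mul0mx mxE addr0 mul1r mul1mx.
have base (N : 'M[R]_n.+1) : N 0 0 != 0 -> N \in unitmx -> vscales (`|\det N|^-1) (mulmx N).
  move=> a0 uN; pose N' : 'M[R]_(1 + n) := N.
  set a := N 0 0 in a0.
  have ula : ulsubmx N' = a%:M.
    apply/matrixP => i j; rewrite !ord1 !mxE/= mulr1n /a; congr (N _ _); exact: val_inj.
  pose S := drsubmx N' - (a^-1 *: dlsubmx N') *m ursubmx N'.
  have dec : N = (block_mx 1%:M 0 (a^-1 *: dlsubmx N') 1%:M : 'M[R]_(1 + n)) *m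
      (block_mx a%:M (ursubmx N') 0 S).
    rewrite mulmx_block !mul1mx !mul0mx !addr0 mul_mx_scalar.
    rewrite scalerA mulfV// scale1r /S addrCA addrN addr0 -ula.
    by rewrite submxK.
  have dN : \det N = a * \det S.
    rewrite {1}dec det_mulmx (@det_lblock R 1 n) (@det_ublock R 1 n) !det1 !mul1r.
    by rewrite det_scalar expr1.
  have uS : S \in unitmx.
    by move: uN; rewrite !unitmxE dN unitrM => /andP[].
  have -> : @mulmx R _ _ 1 N = mulmx (block_mx 1%:M 0 (a^-1 *: dlsubmx N') 1%:M : 'M[R]_(1 + n))
      \o mulmx (block_mx a%:M (ursubmx N') 0 S : 'M[R]_(1 + n)).
    by apply/funext => x /=; rewrite mulmxA -dec.
  rewrite dN normrM invfM -[X in vscales X]mulr1; apply: vscales_comp => //.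
  have S0 : 0 <= `|\det S|^-1 by rewrite invr_ge0.
  have := @vscales_triangular _ _ _ (fun y => (ursubmx N' *m y) 0 0) _ a0 S0
    (measurable_lin (ursubmx N')) (IH _ uS).
  congr vscales; apply/funext => x.
  by rewrite mul_block_vcons scaler0 addr0.
move=> uM; have [a0|/base] := eqVneq (M 0 0) 0; last exact.
have [j Mj] : exists j : 'I_n, M 0 (lift 0 j) != 0.
  apply/existsP; apply: contraT; rewrite negb_exists => /forallP M0.
  move: uM; rewrite unitmxE (expand_det_row _ 0) big1 ?unitr0// => j _.
  case: (unliftP 0 j) => [k|] ->; last by rewrite a0 mul0r.
  by have := M0 k; rewrite negbK => /eqP ->; rewrite mul0r.
pose v : 'cV[R]_n := delta_mx j 0.
(* This adds column [lift 0 j] to column [0]: the corner becomes [M 0 (lift 0 j)] and the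
   determinant is unchanged. *)
pose N : 'M[R]_n.+1 := M *m (block_mx 1%:M 0 v 1%:M : 'M[R]_(1 + n)).
have uv : (block_mx 1%:M 0 v 1%:M : 'M[R]_(1 + n)) \in unitmx.
  by rewrite unitmxE (@det_lblock R 1 n) !det1 mulr1 unitr1.
have uN : N \in unitmx by rewrite unitmx_mul uM uv.
have dN : \det N = \det M by rewrite det_mulmx (@det_lblock R 1 n) !det1 !mulr1.
have N0 : N 0 0 != 0.
  have -> : N 0 0 = (M *m vcons 1 v) 0 0.
    have -> : vcons 1 v = (block_mx 1%:M 0 v 1%:M : 'M[R]_(1 + n)) *m vcons 1 0.
      by rewrite mul_block_vcons vcons0 vconsK mulmx0 mxE mulr1 addr0 mulmx0 add0r scale1r.
    rewrite mulmxA -/N (_ : vcons 1 0 = delta_mx 0 0).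
      by rewrite -colE [RHS]mxE.
    apply/colP => i; case: (unliftP 0 i) => [k|] ->.
      by rewrite vconsS !mxE.
    by rewrite vcons0 mxE.
  rewrite mxE big_ord_recl a0 mul0r add0r (bigD1 j)//= big1 ?addr0.
    by rewrite vconsS mxE !eqxx mulr1.
  by move=> k kj; rewrite vconsS mxE (negbTE kj) mulr0.
rewrite -dN -[X in vscales X]mul1r.
rewrite (_ : @mulmx R _ _ 1 M = mulmx N \o mulmx (block_mx 1%:M 0 (- v) 1%:M : 'M[R]_(1 + n))).
  by apply: vscales_comp => //; exact: base.
have vK : (block_mx 1%:M 0 v 1%:M : 'M[R]_(1 + n)) *m block_mx 1%:M 0 (- v) 1%:M = 1%:M.
  rewrite mulmx_block !(mul1mx, mulmx1, mul0mx, mulmx0, addr0, add0r) subrr.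
  by rewrite -scalar_mx_block.
by apply/funext => x /=; rewrite mulmxA /N -(mulmxA M) vK mulmx1.
Qed.

End Rn_coordinates.

(** * Packings by the integer lattice *)

Section measurable_sets.
Context (R : realType).
Notation mu n := (lebesgue_measure_Rn R n : {measure set (Rn R n) -> \bar R}).

(** A closed set is the intersection over [k] of the countable unions of those boxes of radius
    [1 / (k + 1)] with rational centre that meet it. *)
Lemma vmeasurable_closed n (K : set 'cV[R]_n) : closed K -> vmeasurable K.
Proof.
move=> cK.
pose box (q : 'cV[rat]_n) (k : nat) : set 'cV[R]_n :=
  [set x | forall i, `|x i 0 - ratr (q i 0)| < k.+1%:R^-1].
pose F k q := if `[< box q k `&` K !=set0 >] then box q k else set0.
have KE : K = \bigcap_k \bigcup_q F k q.
  apply/seteqP; split => [x Kx k _|x Fx].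
    have ck : 0 < k.+1%:R^-1 :> R by rewrite invr_gt0.
    have /choice[q qP] (i : 'I_n) : exists q : rat, `|x i 0 - ratr q| < k.+1%:R^-1.
      have [|q] := @rat_in_itvoo R (x i 0 - k.+1%:R^-1) (x i 0 + k.+1%:R^-1).
        by rewrite ltrD2l gtrN.
      by rewrite in_itv/= => qP; exists q; rewrite distrC ltr_distl.
    have bx : box (\col_i q i) k x by move=> i; rewrite mxE.
    by exists (\col_i q i) => //; rewrite /F asboolT//; exists x.
  rewrite (closure_id K).1// => A /nbhs_ballP[e /= e0 eA].
  have [k ke] : exists k : nat, k.+1%:R^-1 < e / 2.
    have e20 : 0 < e / 2 by rewrite divr_gt0.
    by case: (near_infty_natSinv_lt (PosNum e20)) => k _ /(_ k (leqnn k)) /= ?; exists k.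
  have [q _] := Fx k I; rewrite /F; case: ifPn => // /asboolP[y [by_ Ky]] bx.
  exists y; split => //; apply: eA; split => // i j.
  rewrite (ord1 j) /ball/=; have := by_ i; have := bx i.
  rewrite !ltr_norml; move: ke; set c := _^-1 => ? /andP[? ?] /andP[? ?].
  by apply/andP; split; lra.
have mbox q k : vmeasurable (box q k).
  rewrite /vmeasurable (_ : _ @^-1` _ = \bigcap_(i in [set: 'I_n])
      (fun x : Rn R n => Rn_col x i 0) @^-1` ball (ratr (q i 0) : R) k.+1%:R^-1).
    apply: fin_bigcap_measurable => [|i _]; first exact: finite_finset.
    rewrite -[X in measurable X]setTI; apply: measurable_coord => //.
    exact: measurable_ball.
  apply/seteqP; split => x /=; first by move=> xb i _; rewrite /ball/= distrC; exact: xb.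
  by move=> xb i; have := xb i I; rewrite /ball/= distrC.
rewrite KE /vmeasurable preimage_bigcap; apply: bigcap_measurableType => k _.
rewrite preimage_bigcup; apply: countable_bigcupT_measurable => // q.
by rewrite /F; case: ifP => _; [exact: mbox|rewrite preimage_set0].
Qed.

Lemma vmeasurable_compact n (K : set 'cV[R]_n) : compact K -> vmeasurable K.
Proof.
by move=> cK; apply: vmeasurable_closed; apply: compact_closed => //; exact: norm_hausdorff.
Qed.

Lemma le_vol n (A B : set 'cV[R]_n) : vmeasurable A -> vmeasurable B ->
  A `<=` B -> (vol A <= vol B)%E.
Proof.
move=> mA mB AB; apply: (@le_measure _ _ _ (mu n)); rewrite ?inE//.
by move=> x; exact: AB.
Qed.

Lemma vmeasurable_bigcup n (I : countType) (F : I -> set 'cV[R]_n) :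
  (forall i, vmeasurable (F i)) -> vmeasurable (\bigcup_i F i).
Proof.
by move=> mF; rewrite /vmeasurable preimage_bigcup; exact: countable_bigcupT_measurable.
Qed.

(** Countable additivity after reindexing by [nat] through [pickle_inv]; integers that code no index
    contribute the empty set. *)
Lemma eq_vol_bigcup n (I : countType) (F G : I -> set 'cV[R]_n) :
  trivIset setT F -> trivIset setT G ->
  (forall i, vmeasurable (F i)) -> (forall i, vmeasurable (G i)) ->
  (forall i, vol (F i) = vol (G i)) ->
  vol (\bigcup_i F i) = vol (\bigcup_i G i).
Proof.
move=> tF tG mF mG FG.
pose seqs (H : I -> set 'cV[R]_n) k := oapp H set0 (pickle_inv k).
have seqsE H : \bigcup_i H i = \bigcup_k seqs H k.
  apply/seteqP; split => x [i _ Hx].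
    by exists (pickle i) => //; rewrite /seqs pickleK_inv.
  by move: Hx; rewrite /seqs; case: pickle_inv => // j; exists j.
have volE H : trivIset setT H -> (forall i, vmeasurable (H i)) ->
    vol (\bigcup_i H i) = (\sum_(0 <= k <oo | k \in setT) vol (seqs H k))%E.
  move=> tH mH; rewrite seqsE /vol preimage_bigcup.
  apply: (@measure_bigcup _ _ _ (mu n)) => [k _|].
    by rewrite /seqs; case: pickle_inv => [i|]/=; [exact: mH|rewrite preimage_set0].
  apply/trivIsetP => k l _ _ kl; rewrite -preimage_setI.
  rewrite (_ : _ `&` _ = set0) ?preimage_set0// /seqs.
  case ek : (pickle_inv k) => [i|]/=; last by rewrite set0I.
  case el : (pickle_inv l) => [j|]/=; last by rewrite setI0.
  move/trivIsetP : tH; apply => //; apply: contra_neq kl => ij; rewrite ij in ek.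
  have := @pickle_invK I k; have := @pickle_invK I l.
  by rewrite ek el /= => -> ->.
rewrite !volE//; apply: eq_eseriesr => k _.
by rewrite /seqs; case: pickle_inv.
Qed.

Definition unit_cube n : set 'cV[R]_n := [set x | forall i, 0 <= x i 0 < 1].
Arguments unit_cube : clear implicits.

Lemma unit_cubeS n (t : R) (y : 'cV[R]_n) :
  unit_cube n.+1 (vcons t y) <-> 0 <= t < 1 /\ unit_cube n y.
Proof.
split=> [c|[ct cy] i].
  by split=> [|i]; [have := c 0; rewrite vcons0|have := c (lift 0 i); rewrite vconsS].
by case: (unliftP 0 i) => [k|] ->; rewrite ?vconsS ?vcons0.
Qed.

Lemma vol_unit_cube n : vmeasurable (unit_cube n) /\ vol (unit_cube n) = 1%E.
Proof.
elim: n => [|n [mQ vQ]].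
  rewrite /vmeasurable (_ : _ @^-1` _ = setT); last by apply/seteqP; split => // x _ [].
  split => //; rewrite /vol (_ : _ @^-1` _ = setT); last by apply/seteqP; split => // x _ [].
  exact: diracT.
have e : Rn_col (n:=n.+1) @^-1` unit_cube n.+1 =
    ([set` `[0, 1[] : set (measurableTypeR R)) `*` (Rn_col (n:=n) @^-1` unit_cube n).
  apply/seteqP; split => -[t y] /=; rewrite in_itv/=.
    by rewrite -/(vcons t (Rn_col y)) => /unit_cubeS.
  by move=> [? ?]; apply/unit_cubeS.
split; first by rewrite /vmeasurable e; exact: measurableX.
rewrite /vol e; apply: (etrans (product_measure1E _ _ _ _)) => //.
by rewrite -/(vol _) vQ mule1 /= lebesgue_measure_itv/= lte_fin ltr01 oppr0 adde0.
Qed.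

(** Cut [A] along the integer translates of the unit cube and move each piece [F z] back into the
    cube, where it becomes [G z]. The hypothesis makes the [G z] disjoint, so their volumes add up
    to at most 1. *)
Lemma Blichfeldt n (A : set 'cV[R]_n) : vmeasurable A ->
  (forall x (z : 'cV[int]_n), A x -> A (x + map_mx intr z) -> z = 0) ->
  (vol A <= 1)%E.
Proof.
move=> mA Az; have [mQ vQ] := vol_unit_cube n.
pose G (z : 'cV[int]_n) := unit_cube n `&` (fun x => x + map_mx intr z) @^-1` A.
pose F (z : 'cV[int]_n) := A `&` (fun x => x - map_mx intr z) @^-1` unit_cube n.
have mG z : vmeasurable (G z).
  rewrite /vmeasurable preimage_setI; apply: measurableI => //.
  by have [] := vscalesE (vscales_translate (map_mx intr z)) mA.
have mF z : vmeasurable (F z).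
  rewrite /vmeasurable preimage_setI; apply: measurableI => //.
  by have [] := vscalesE (vscales_translate (- map_mx intr z)) mQ.
have AE : A = \bigcup_z F z.
  apply/seteqP; split => [x Ax|x [z _ []]//].
  exists (\col_i Num.floor (x i 0)) => //; split => // i; rewrite !mxE.
  have /andP[] := floor_itv (x i 0); rewrite intrD => ? ?; apply/andP; split; lra.
rewrite AE (eq_vol_bigcup (G := G))//.
- by rewrite -vQ; apply: le_vol => //; [exact: vmeasurable_bigcup|move=> x [z _ []]].
- apply/trivIsetP => z z' _ _; apply: contraNeq => /set0P[x [[Ax Qx] [_ Qx']]].
  apply/eqP/colP => i; have := Qx i; have := Qx' i; rewrite !mxE.
  move=> /andP[a1 a2] /andP[b1 b2].
  suff : (z i 0 - z' i 0 < 1) /\ (z' i 0 - z i 0 < 1) by lia.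
  by split; rewrite -(ltr_int R) intrB; lra.
- apply/trivIsetP => z z' _ _; apply: contraNeq => /set0P[x [[_ /= Az1] [_ /= Az2]]].
  rewrite -subr_eq0 -oppr_eq0 opprB; apply/eqP; apply: Az Az1 _.
  by rewrite map_mxB addrA [x + _ + _]addrAC addrK.
- move=> z; have [_] := vscalesE (vscales_translate (map_mx intr z)) (mF z).
  rewrite mul1e => <-; congr vol; apply/seteqP; split => x /= [].
    by move=> Ax /=; rewrite addrK.
  by move=> Qx Ax; split => //=; rewrite addrK.
Qed.

End measurable_sets.

(** * Fibre points, the triangular stretching map, and the packing bound on the volume *)

Section convexity.
Context (R : realType).

Definition convex n (K : set 'cV[R]_n) := forall x y s, K x -> K y ->
  0 <= s <= 1 -> K (s *: x + (1 - s) *: y).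

Lemma convex_setE n (K : set 'cV[R]_n) : convex_set K -> convex K.
Proof.
move=> cK x y s Kx Ky /andP[s0 s1].
have := cK x y (Itv01 s0 s1); rewrite !inE => /(_ Kx Ky).
by [].
Qed.

Lemma continuous_col (T : topologicalType) n (f : T -> 'cV[R]_n) :
  (forall i, continuous (fun x => f x i 0)) -> continuous f.
Proof.
move=> cf x A /nbhs_ballP[e /= e0 eA].
have : \forall y \near x, forall i, ball (f x i 0) e (f y i 0).
  apply: filter_forall => i.
  exact: (cf i x _ (nbhsx_ballx (f x i 0) e e0)).
apply: filterS => y xy; apply: eA; split => // i j; rewrite (ord1 j).
exact: xy.
Qed.

Lemma continuous_vtail n : continuous (@vtail R n).
Proof.
apply: continuous_col => i; under eq_fun do rewrite vtailE.
exact: coord_continuous.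
Qed.

Lemma compact_vtail n (K : set 'cV[R]_n.+1) : compact K -> compact (@vtail R n @` K).
Proof.
move=> cK; apply: continuous_compact => //; apply: continuous_subspaceT.
exact: continuous_vtail.
Qed.

Lemma convex_vtail n (K : set 'cV[R]_n.+1) : convex K -> convex (@vtail R n @` K).
Proof.
move=> cK _ _ s [x Kx <-] [y Ky <-] s01.
by exists (s *: x + (1 - s) *: y); rewrite ?vtailD ?vtailZ//; exact: cK.
Qed.

(* [top K y] is [0] when the fibre of [K] over [y] is empty. *)
Definition top n (K : set 'cV[R]_n.+1) (y : 'cV[R]_n) : R :=
  xget 0 [set t | K (vcons t y) /\ forall t', K (vcons t' y) -> t' <= t].

(** The fibre over [y] is compact and nonempty, so the first coordinate attains its maximum
    there. *)
Lemma topP n (K : set 'cV[R]_n.+1) y : compact K -> (@vtail R n @` K) y ->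
  K (vcons (top K y) y) /\ forall t, K (vcons t y) -> t <= top K y.
Proof.
move=> cK Ky; rewrite /top; case: xgetP => [t -> //|nt]; exfalso.
pose S := K `&` (@vtail R n @^-1` [set y]).
have cS : compact S.
  apply: compact_closedI => //; apply: preimage_closed.
    by move=> x _; exact: continuous_vtail.
  apply: accessible_closed_set1; apply: hausdorff_accessible.
  exact: norm_hausdorff.
have S0 : S !=set0 by case: Ky => x Kx xy; exists x.
have [|x /set_mem[Kx /= xy] xmax] := @compact_EVT_max _ R (fun x : 'cV[R]_n.+1 => x 0 0) S S0 cS.
  by apply: continuous_subspaceT; exact: coord_continuous.
apply: (nt (x 0 0)); split; first by rewrite -xy vcons_eta.
move=> t Kt; have := xmax (vcons t y); rewrite vcons0; apply.
by apply/mem_set; split => //; rewrite /= vconsK.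
Qed.

(** On the projection [P] of [K], the set where [top] is at least [a] is the projection of a compact
    part of [K]. Off [P] the default value [0] applies, so the complement of [P] is added exactly
    when [a <= 0]. *)
Lemma measurable_top n (K : set 'cV[R]_n.+1) : compact K ->
  measurable_fun setT (fun y : Rn R n => top K (Rn_col y)).
Proof.
move=> cK; apply: (measurability (@RGenCInfty.G R)) => [|/= _ [_] [a] -> <-].
  exact: RGenCInfty.measurableE.
rewrite setTI.
pose P := @vtail R n @` K; pose Ka := K `&` (fun x => x 0 0) @^-1` [set t | a <= t].
have cP : vmeasurable P by apply: vmeasurable_compact; exact: compact_vtail.
have cKa : vmeasurable (@vtail R n @` Ka).
  apply: vmeasurable_compact; apply: compact_vtail; apply: compact_closedI => //.
  apply: preimage_closed; last exact: closed_ge.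
  by move=> x _; exact: coord_continuous.
have top0 y : ~ P y -> top K y = 0.
  move=> Py; rewrite /top; case: xgetP => // t _ [Kt _].
  by exfalso; apply: Py; exists (vcons t y); rewrite ?vconsK.
rewrite (_ : _ @^-1` _ = (Rn_col (n:=n) @^-1` (@vtail R n @` Ka)) `|`
  (if a <= 0 then ~` (Rn_col (n:=n) @^-1` P) else set0)).
  by apply: measurableU => //; case: ifP => // _; exact: measurableC.
apply/seteqP; split => y; rewrite /= in_itv/= andbT.
  move=> ay; have [Py|Py] := pselect (P (Rn_col y)); last first.
    by right; rewrite -(top0 _ Py) ay.
  left; exists (vcons (top K (Rn_col y)) (Rn_col y)); last by rewrite vconsK.
  by split; [exact: (topP cK Py).1|rewrite /= vcons0].
move=> [[x [Kx /= ax] xy]|].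
  apply: (le_trans ax); apply: (topP cK _).2; first by exists x.
  by rewrite -xy vcons_eta.
by case: ifP => // a0 /top0 ->.
Qed.

(* For [x] in [K], a point of [K] that agrees with [x] at the indices [>= k];
   it depends only on these coordinates. *)
Fixpoint fibre_point n : set 'cV[R]_n -> nat -> 'cV[R]_n -> 'cV[R]_n :=
  match n with
  | 0 => fun _ _ x => x
  | m.+1 => fun K k x =>
    if k is k'.+1 then
      let y := fibre_point (@vtail R m @` K) k' (vtail x) in vcons (top K y) y
    else x
  end.

Lemma fibre_point_in n (K : set 'cV[R]_n) k x : compact K -> K x -> K (fibre_point K k x).
Proof.
elim: n K k x => [//|n IH] K [//|k] x cK Kx /=.
by apply: (topP cK _).1; apply: IH; [exact: compact_vtail|exists x].
Qed.

Lemma eq_fibre_point n (K : set 'cV[R]_n) k (x y : 'cV[R]_n) :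
  (forall i : 'I_n, (k <= i)%N -> x i 0 = y i 0) -> fibre_point K k x = fibre_point K k y.
Proof.
elim: n K k x y => [|n IH] K k x y xy /=; first by apply/colP => -[].
case: k xy => [|k] xy; first by apply/colP => i; exact: xy.
rewrite (IH _ k (vtail x) (vtail y)) // => i ki; rewrite !vtailE; exact: xy.
Qed.

Lemma measurable_fibre_point n (K : set 'cV[R]_n) k : compact K ->
  measurable_fun setT (on_Rn (fibre_point K k)).
Proof.
elim: n K k => [|n IH] K k cK.
  by apply: measurable_fun_Rn => -[].
case: k => [|k].
  rewrite (_ : on_Rn _ = id)//; apply/funext => x; exact: Rn_colK.
have mk := IH _ k (compact_vtail cK).
rewrite (_ : on_Rn _ = fun x : Rn R n.+1 =>
  let y := on_Rn (fibre_point (@vtail R n @` K) k) x.2 in (top K (Rn_col y), y)).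
  apply: measurable_fun_pair => /=.
    apply: (measurableT_comp (measurable_top cK)).
    by apply: (measurableT_comp mk); exact: measurable_snd.
  by apply: (measurableT_comp mk); exact: measurable_snd.
apply/funext => x; rewrite /on_Rn Rn_colS /= vcons0 !vconsK.
by rewrite col_RnK.
Qed.

(** The coefficients [r 0] and [r (j + 1) - r j] are nonnegative and telescope to [r k], so the sum
    is [r k] times a convex combination. *)
Lemma sum_convex n (K : set 'cV[R]_n) (r : nat -> R) (c : nat -> 'cV[R]_n) k :
  convex K -> (forall j, K (c j)) -> 0 < r 0%N ->
  {homo r : i j / (i <= j)%N >-> i <= j} ->
  exists2 a, K a &
    r 0%N *: c 0%N + \sum_(j < k) (r j.+1 - r j) *: c j.+1 = r k *: a.
Proof.
move=> cK Kc r0 rh; elim: k => [|k [a Ka IH]].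
  by exists (c 0%N) => //; rewrite big_ord0 addr0.
have rk : 0 < r k.+1 by apply: (lt_le_trans r0); exact: rh.
exists ((r k / r k.+1) *: a + (1 - r k / r k.+1) *: c k.+1).
  apply: cK => //; rewrite divr_ge0/= ?(ltW rk)//; last first.
    by apply: ltW; apply: (lt_le_trans r0); exact: rh.
  by rewrite ler_pdivrMr// mul1r rh.
rewrite big_ord_recr/= addrA IH scalerDr !scalerA; congr (_ *: _ + _ *: _).
  by rewrite mulrC divfK// gt_eqF.
by rewrite mulrBr mulr1 [r k.+1 * _]mulrC divfK// gt_eqF.
Qed.

(* [stretch] is defined coordinate by coordinate, which exhibits it as triangular;
   [stretchE] is its expression as a combination of points of [K]. *)
Definition offset n (K : set 'cV[R]_n.+1) (r : nat -> R) (y : 'cV[R]_n) : R :=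
  \sum_(k < n) (r k.+1 - r k) * top K (fibre_point (@vtail R n @` K) k y).

Fixpoint stretch n : set 'cV[R]_n -> (nat -> R) -> 'cV[R]_n -> 'cV[R]_n :=
  match n with
  | 0 => fun _ _ x => x
  | m.+1 => fun K r x =>
    vcons (r 0%N * x 0 0 + offset K r (vtail x))
          (stretch (@vtail R m @` K) (r \o S) (vtail x))
  end.

Lemma stretchS n (K : set 'cV[R]_n.+1) r x : stretch K r x =
  vcons (r 0%N * x 0 0 + offset K r (vtail x))
        (stretch (@vtail R n @` K) (r \o S) (vtail x)).
Proof. by []. Qed.

Lemma stretchE n (K : set 'cV[R]_n.+1) r x : stretch K r x =
  r 0%N *: x + \sum_(j < n) (r j.+1 - r j) *: fibre_point K j.+1 x.
Proof.
elim: n K r x => [|n IH] K r x.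
  rewrite big_ord0 addr0 /= /offset big_ord0 addr0 -[x in RHS]vcons_eta vconsZ.
  by congr vcons; apply/colP => -[].
set K' := @vtail R n.+1 @` K.
rewrite stretchS -/K' (IH K') /offset -[x in RHS]vcons_eta vconsZ.
under [in RHS]eq_bigr do rewrite /= vconsK vconsZ.
rewrite vcons_sum vconsD; congr vcons.
(* As [fibre_point] at index 0 is the identity, the term [j = 0] has tail [vtail x]; it raises the
   coefficient [r 0] to [r 1], the first value of the shifted sequence. *)
rewrite big_ord_recl /= addrA -scalerDl [r 0%N + _]addrC subrK.
by [].
Qed.

(** The map is triangular with nonzero slopes, so coordinates are recovered from the last one
    upwards, and those of index at least [k] depend only on image coordinates of index at least
    [k]. *)
Lemma stretch_inj n (K : set 'cV[R]_n) (r : nat -> R) k (x y : 'cV[R]_n) :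
  (forall j, r j != 0) ->
  (forall i : 'I_n, (k <= i)%N -> stretch K r x i 0 = stretch K r y i 0) ->
  forall i : 'I_n, (k <= i)%N -> x i 0 = y i 0.
Proof.
elim: n K r k x y => [K r k x y _ _ []//|n IH] K r k x y r0 e.
have tl k' : (k <= k'.+1)%N -> forall i : 'I_n, (k' <= i)%N -> vtail x i 0 = vtail y i 0.
  move=> kk'; apply: (IH (@vtail R n @` K) (r \o S)) => [j|i ki]; first exact: r0.
  have := e (lift 0 i); rewrite /= !vconsS; apply.
  by rewrite /bump/= add1n; exact: (leq_trans kk').
move=> i ki; case: (unliftP 0 i) ki => [j|] -> ki.
  by rewrite -!vtailE; exact: (tl j).
have txy : vtail x = vtail y by apply/colP => j; exact: (tl 0%N (leqW ki)).
have := e 0 ki; rewrite /= !vcons0 txy => /addIr; exact: mulfI.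
Qed.

(** Back substitution: the tail is solved first and determines the offset of the head. Through this
    inverse, the image of [K] under [stretch] is handled as a preimage, the form in which [vscales]
    applies. *)
Fixpoint shrink n : set 'cV[R]_n -> (nat -> R) -> 'cV[R]_n -> 'cV[R]_n :=
  match n with
  | 0 => fun _ _ x => x
  | m.+1 => fun K r u =>
    let y := shrink (@vtail R m @` K) (r \o S) (vtail u) in
    vcons ((r 0%N)^-1 * u 0 0 + - (r 0%N)^-1 * offset K r y) y
  end.

Lemma shrinkK n (K : set 'cV[R]_n) r : (forall j, r j != 0) ->
  cancel (shrink K r) (stretch K r).
Proof.
elim: n K r => [//|n IH] K r r0 u /=.
rewrite vcons0 !vconsK IH; last by move=> j; exact: r0.
by rewrite -[RHS]vcons_eta mulrDr !mulrA mulrN mulfV// mul1r mulN1r subrK.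
Qed.

(** Triangular with slopes [(r j)^-1], each contributing the factor [r j] to the volume of
    preimages. *)
Lemma vscales_shrink n (K : set 'cV[R]_n) (r : nat -> R) : compact K -> (forall j, 0 < r j) ->
  vscales (\prod_(j < n) r j) (shrink K r).
Proof.
elim: n K r => [|n IH] K r cK r0.
  rewrite big_ord0 /vscales (_ : on_Rn _ = id); first exact: scales_id.
  by apply/funext => -[].
have sT := IH _ (r \o S) (compact_vtail cK) (fun j => r0 j.+1).
have p0 : 0 <= \prod_(j < n) (r \o S) j by apply: prodr_ge0 => j _; exact: (ltW (r0 _)).
have i0 : (r 0%N)^-1 != 0 by rewrite invr_eq0 gt_eqF.
have := @vscales_triangular _ _ (r 0%N)^-1 _ (fun v => - (r 0%N)^-1 * 
   offset K r (shrink (@vtail R n @` K) (r \o S) v)) _ i0 p0 _ sT.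
rewrite big_ord_recl gtr0_norm ?invr_gt0// invrK; apply.
apply: measurable_funM => //; rewrite /offset.
apply: measurable_sum => k; apply: measurable_funM => //.
rewrite (_ : (fun _ => _) = (fun y => top K (Rn_col y)) \o
  (on_Rn (fibre_point (@vtail R n @` K) k) \o on_Rn (shrink (@vtail R n @` K) (r \o S)))).
  apply: (measurableT_comp (measurable_top cK)).
  apply: measurableT_comp; last exact: sT.1.
  by apply: measurable_fibre_point; exact: compact_vtail.
by apply/funext => x; rewrite /= /on_Rn !col_RnK.
Qed.

(** [Blichfeldt] applied to the stretched body. Indices count from 0, so [r k] is the multiplier
    attached to coordinate [k]. *)
Theorem packing_volume_le n (K : set 'cV[R]_n) (r : nat -> R) :
  compact K -> convex K -> 0 < r 0%N ->
  {homo r : i j / (i <= j)%N >-> i <= j} ->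
  (forall (k : 'I_n) (z : 'cV[int]_n) a b, K a -> K b ->
    map_mx intr z = r k *: (a - b) -> forall j : 'I_n, (k <= j)%N -> z j 0 = 0) ->
  ((\prod_(j < n) r j)%:E * vol K <= 1)%E.
Proof.
move=> cK cvK r0 rh hz.
have r_gt0 j : 0 < r j by apply: (lt_le_trans r0); exact: rh.
have rn0 j : r j != 0 by rewrite gt_eqF.
have [mA <-] := vscalesE (vscales_shrink cK r_gt0) (vmeasurable_compact cK).
apply: Blichfeldt => // u z /= Ku Kuz; apply/eqP; apply: contraT => z0.
have [k0 zk0] : exists k, z k 0 != 0.
  apply/existsP; apply: contraNT z0; rewrite negb_exists => /forallP z0.
  by apply/eqP/colP => i; have := z0 i; rewrite negbK mxE => /eqP.
(* [k] is the last index at which the lattice vector [z] is nonzero. *)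
case: (@arg_maxnP _ k0 (fun k => z k 0 != 0) (@nat_of_ord n) zk0) => k zk kmax.
case: n => [|n] in K cK cvK hz mA u z Ku Kuz z0 k0 zk0 k zk kmax *.
  by case: k {zk kmax}.
set x := shrink K r u; set x' := shrink K r (u + map_mx intr z).
have xu : stretch K r x = u by exact: shrinkK.
have xu' : stretch K r x' = u + map_mx intr z by exact: shrinkK.
(* The two images agree beyond [k], hence so do [x] and [x'], and hence also their fibre points of
   index greater than [k]. *)
have xx' : forall i : 'I_n.+1, (k < i)%N -> x i 0 = x' i 0.
  apply: (stretch_inj (K := K) (r := r)) => // i ki.
  rewrite xu xu' !mxE; have [->|zi] := eqVneq (z i 0) 0; first by rewrite addr0.
  by have /= := kmax i zi; rewrite leqNgt ki.
have cc j : (k <= j)%N -> fibre_point K j.+1 x = fibre_point K j.+1 x'.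
  by move=> kj; apply: eq_fibre_point => i ji; apply: xx'; exact: leq_trans ji.
pose c y j := fibre_point K j y.
have [a Ka ea] := @sum_convex _ K r (c x) k cvK (fun j => fibre_point_in j cK Ku) r0 rh.
have [b Kb eb] := @sum_convex _ K r (c x') k cvK (fun j => fibre_point_in j cK Kuz) r0 rh.
suff zab : map_mx intr z = r k *: (b - a).
  by have := hz k z b a Kb Ka zab k (leqnn _) => /eqP; rewrite (negbTE zk).
have -> : map_mx intr z = stretch K r x' - stretch K r x by rewrite xu xu' addrAC subrr add0r.
(* Split the sum at [k]: by [sum_convex] the first part is [r k] times a point of [K], while the
   second part is common to [x] and [x'] and cancels. *)
have split y : stretch K r y = (r 0%N *: c y 0%N + \sum_(j < k) (r j.+1 - r j) *: c y j.+1)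
    + \sum_(k <= j < n) (r j.+1 - r j) *: c y j.+1.
  rewrite stretchE -addrA; congr (_ + _).
  have kn : (k <= n)%N by rewrite -ltnS.
  by rewrite -!(big_mkord xpredT (fun j => (r j.+1 - r j) *: c y j.+1)) -big_cat_nat.
rewrite !split ea eb scalerBr.
rewrite (eq_big_nat _ _ (F2 := fun j => (r j.+1 - r j) *: c x j.+1)); last first.
  by move=> j /andP[kj _]; rewrite /c cc.
by rewrite opprD addrACA subrr addr0.
Qed.

End convexity.

(** * Cones and chords *)

Section cone.
Context (R : realType).
Notation mu n := (lebesgue_measure_Rn R n : {measure set (Rn R n) -> \bar R}).

Lemma continuous_vcons (T : topologicalType) n (f : T -> R) (g : T -> 'cV[R]_n) :
  continuous f -> continuous g -> continuous (fun x => vcons (f x) (g x)).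
Proof.
move=> cf cg; apply: continuous_col => i; case: (unliftP 0 i) => [k|] ->.
  under eq_fun do rewrite vconsS.
  move=> x; apply: (@continuous_comp _ _ _ g (fun y : 'cV[R]_n => y k 0)).
    exact: cg.
  exact: coord_continuous.
by under eq_fun do rewrite vcons0.
Qed.

Lemma ge0_integral_onemXn n :
  (\int[@lebesgue_measure R]_(x in `[0%R, 1%R]) ((1 - x) ^+ n)%R%:E =
   (n.+1%:R^-1)%R%:E)%E.
Proof.
rewrite (@continuous_FTC2 _ _ (fun x : R => x.~ ^+ n.+1 / - n.+1%:R))//=.
- rewrite onem1 expr0n/= mul0r onem0 expr1n mul1r -EFinB sub0r.
  by rewrite -invrN opprK.
- by apply: continuous_in_subspaceT => x x01; exact: continuous_onemXn.
- exact: derivable_oo_LRcontinuous_onemXnMr.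
- move=> x x01; rewrite derive1Mr//; last exact: onemXn_derivable.
  by rewrite derive_onemXn mulrAC divff// mul1r.
Qed.

Lemma vol_homothety n (P : set 'cV[R]_n) (s : R) (v : 'cV[R]_n) :
  vmeasurable P -> 0 < s ->
  vol ((fun y => s^-1 *: (y - v)) @^-1` P) = ((s ^+ n)%:E * vol P)%E.
Proof.
move=> mP s0; have us : s^-1%:M \in @unitmx R n.
  by rewrite unitmxE det_scalar unitrX// unitfE invr_eq0 gt_eqF.
have := vscales_comp (vscales_translate (- v)) (vscales_mulmx us).
rewrite (_ : _ \o _ = (fun y => s^-1 *: (y - v))); last first.
  by apply/funext => y /=; rewrite mul_scalar_mx.
move=> /vscalesE /(_ mP)[_ ->]; rewrite mul1r det_scalar exprVn normfV invrK.
by rewrite ger0_norm// exprn_ge0// ltW.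
Qed.

(** [E] is the cone with base [P] at height 0 and apex [p] at height 1. If [E] has a point at height
    [u] over [y], a convex combination of a point of [K] with the given chord puts a segment of
    length [l * u] in the fibre of [K] over [y]. So each fibre of [K] is at least [l] times as long
    as that of [E]. *)
Lemma vol_cone n (K : set 'cV[R]_n.+1) (t l : R) (p : 'cV[R]_n) :
  compact K -> convex K -> 0 < l -> K (vcons t p) -> K (vcons (t + l) p) ->
  ((l / n.+1%:R)%:E * vol (@vtail R n @` K) <= vol K)%E.
Proof.
move=> cK cvK l0 Kt Ktl; set P := _ @` K.
have cP : compact P by exact: compact_vtail.
have mP := vmeasurable_compact cP.
have mK := vmeasurable_compact cK.
pose h (x : R * 'cV[R]_n) := vcons x.1 ((1 - x.1) *: x.2 + x.1 *: p).
pose E : set 'cV[R]_n.+1 := h @` ([set` `[0, 1]] `*` P).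
have mE : vmeasurable E.
  apply: vmeasurable_compact; apply: continuous_compact.
    apply: continuous_subspaceT; apply: continuous_vcons => x; first exact: cvg_fst.
    apply: cvgD; last by apply: cvgZr_tmp; exact: cvg_fst.
    apply: cvgZ; last exact: cvg_snd.
    by apply: cvgB; [exact: cvg_cst|exact: cvg_fst].
  by apply: compact_setX => //; exact: segment_compact.
have EP u y : E (vcons u y) <->
    exists q, [/\ 0 <= u <= 1, P q & y = (1 - u) *: q + u *: p].
  split=> [[[u' q] [/= u01 Pq]] /vcons_inj[<- <-]|[q [u01 Pq ->]]].
    by exists q; split => //; move: u01; rewrite in_itv.
  by exists (u, q) => //; split => //=; rewrite in_itv.
have volE : ((n.+1%:R^-1)%:E * vol P <= vol E)%E.
  rewrite -ge0_integral_onemXn -ge0_integralZr//; last 2 first.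
  - by apply/measurable_EFinP; apply: measurable_funX; exact: measurable_funB.
  - by move=> u; rewrite /= in_itv/= lee_fin => /andP[_ u1]; rewrite exprn_ge0// subr_ge0.
  rewrite /vol [X in (_ <= X)%E](lebesgue_measure_RnS1 mE).
  have mX := measurable_fun_xsection (lebesgue_measure_Rn R n) mE.
  (* Dropping the apex [u = 1] keeps [1 - u] positive, so each slice of [E] is a homothetic copy of
     [P]. *)
  rewrite -integral_itv_bndo_bndc; last first.
    apply: measurable_funTS; apply: emeasurable_funM => //.
    by apply/measurable_EFinP; apply: measurable_funX; exact: measurable_funB.
  apply: (@le_trans _ _ (\int[@lebesgue_measure R]_(u in `[0%R, 1%R[)
      (mu n (xsection (Rn_col (n:=n.+1) @^-1` E) u)))%E); last first.
    by apply: ge0_subset_integral => // u _; exact: measure_ge0.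
  rewrite le_eqVlt; apply/orP; left; apply/eqP; apply: eq_integral => u.
  rewrite inE/= in_itv/= => /andP[u0 u1].
  have u1' : 0 < 1 - u by rewrite subr_gt0.
  rewrite -(vol_homothety (u *: p) mP u1') /vol; congr (lebesgue_measure_Rn R n _).
  apply/seteqP; split => y /=; rewrite /xsection/= inE/=.
    move=> Py; apply/EP; exists ((1 - u)^-1 *: (Rn_col y - u *: p)); split => //.
      by rewrite u0 ltW.
    by rewrite scalerA mulfV ?gt_eqF// scale1r subrK.
  move=> /EP[q [_ Pq ->]].
  by rewrite addrK scalerA mulVf ?gt_eqF// scale1r.
have section y : (l%:E * @lebesgue_measure R [set u | E (vcons u y)]
    <= @lebesgue_measure R [set u | K (vcons u y)])%E.
  set M := lebesgue_measure [set u | K _].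
  have mKy : measurable ([set u | K (vcons u y)] : set (measurableTypeR R)).
    have := measurable_ysection (col_Rn y) mK; congr measurable.
    by apply/seteqP; split => u /=; rewrite /ysection/= inE/= col_RnK.
  have mEy : measurable ([set u | E (vcons u y)] : set (measurableTypeR R)).
    have := measurable_ysection (col_Rn y) mE; congr measurable.
    by apply/seteqP; split => u /=; rewrite /ysection/= inE/= col_RnK.
  have chord u : E (vcons u y) -> ((l * u)%:E <= M)%E.
    move=> /EP[_ [/andP[u0 u1] [x Kx <-] yE]].
    set a := (1 - u) * x 0 0 + u * t.
    have lu0 : 0 <= l * u by rewrite mulr_ge0// ltW.
    have -> : ((l * u)%:E = @lebesgue_measure R `[a, (a + l * u)%R])%E.
      rewrite lebesgue_measure_itv/= lte_fin ltrDl; case: ltP => [_|lu].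
        by rewrite -EFinB addrAC subrr add0r.
      by congr EFin; apply/eqP; rewrite eq_le lu lu0.
    apply: le_measure; rewrite ?inE// => b; rewrite /= in_itv/= => /andP[ab bal].
    (* The relative position of [b] on the segment from [a]; when [l * u = 0] the quotient is 0 by
       convention and [b = a]. *)
    pose c := (b - a) / (l * u).
    have c01 : 0 <= c <= 1.
      rewrite /c divr_ge0 ?subr_ge0//=.
      have [->|lun0] := eqVneq (l * u) 0; first by rewrite invr0 mulr0 ler01.
      by rewrite ler_pdivrMr ?lt_def ?lun0// mul1r lerBlDl.
    have Kc := cvK _ _ c Ktl Kt c01.
    have u01 : 0 <= 1 - u <= 1 by rewrite subr_ge0 u1 lerBlDr lerDl.
    have := cvK _ _ (1 - u) Kx Kc u01.
    rewrite -{1}(vcons_eta x) !vconsZ !vconsD !vconsZ vconsD; congr (K (vcons _ _)).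
      have -> : b = a + c * (l * u).
        rewrite /c; have [lu|lun0] := eqVneq (l * u) 0.
          rewrite lu mulr0 addr0; apply/eqP; rewrite eq_le ab andbT.
          by rewrite lu addr0 in bal.
        by rewrite divfK// addrC subrK.
      by rewrite /a; ring.
    by rewrite yE subKr -scalerDl [c + _]addrC subrK scale1r.
  case M_ : M chord => [m| |] chord; last 2 first.
  - exact: leey.
  - by have : (0 <= M)%E := measure_ge0 _ _; rewrite M_.
  have m0 : 0 <= m by rewrite -lee_fin -M_; exact: measure_ge0.
  (* All heights in the fibre of [E] satisfy [l * u <= m], so this fibre lies in [[0, m / l]]. *)
  apply: (@le_trans _ _ (l%:E * @lebesgue_measure R `[0%R, (m / l)%R])%E).
    apply: lee_wpmul2l; first by rewrite lee_fin ltW.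
    apply: le_measure; rewrite ?inE// => u Eu; rewrite /= in_itv/=.
    have := chord _ Eu; rewrite lee_fin ler_pdivlMr// mulrC => ->.
    by have /EP[_ [/andP[-> _] _ _]] := Eu.
  rewrite lebesgue_measure_itv/= lte_fin; case: ifP => _; last by rewrite mule0 lee_fin.
  by rewrite oppr0 adde0 -EFinM mulrC divfK// gt_eqF.
rewrite EFinM -muleA.
apply: (@le_trans _ _ (l%:E * vol E)%E).
  by apply: lee_wpmul2l => //; rewrite lee_fin ltW.
rewrite /vol [X in (l%:E * X <= _)%E](lebesgue_measure_RnS2 mE).
rewrite [X in (_ <= X)%E](lebesgue_measure_RnS2 mK).
have mYE := measurable_fun_ysection (@lebesgue_measure R) mE.
have mYK := measurable_fun_ysection (@lebesgue_measure R) mK.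
rewrite -ge0_integralZl//; last by rewrite lee_fin ltW.
apply: ge0_le_integral => //.
- by move=> y _; apply: mule_ge0 => //; rewrite lee_fin ltW.
- exact: emeasurable_funM.
move=> y _; have := section (Rn_col y); congr (_ * lebesgue_measure _ <= lebesgue_measure _)%E.
  by apply/seteqP; split => u /=; rewrite /ysection/= inE.
by apply/seteqP; split => u /=; rewrite /ysection/= inE.
Qed.

End cone.

(** * Unimodular bases adapted to a flag *)

Section flag.

(** This is the Smith normal form of a one-column matrix. *)
Lemma unimodular_col n (u : 'cV[int]_n.+1) :
  exists2 U : 'M[int]_n.+1, U \in unitmx & exists d, U *m u = vcons d 0.
Proof.
have [L uL [Q uQ [d _ ->]]] := int_Smith_normal_form u.
exists (invmx L); first by rewrite unitmx_inv.
exists (d`_0 * Q 0 0); rewrite -mulmxA mulKmx//.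
apply/colP => i; rewrite mxE big_ord1 mxE; case: (unliftP 0 i) => [k|] ->.
  by rewrite vconsS mulr0n mul0r mxE.
by rewrite vcons0 mulr1n.
Qed.

Lemma vtail_mulmx (R : nzRingType) m n (M : 'M[R]_(n.+1, m)) (x : 'cV_m) :
  vtail (M *m x) = dsubmx (M : 'M[R]_(1 + n, m)) *m x.
Proof.
apply/colP => i; rewrite vtailE !mxE; apply: eq_bigr => k _; rewrite mxE.
by congr (M _ k * _); exact: val_inj.
Qed.

Lemma map_vtail (R : nzRingType) n (z : 'cV[int]_n.+1) :
  map_mx intr (vtail z) = vtail (map_mx intr z) :> 'cV[R]_n.
Proof. by apply/colP => i; rewrite mxE !vtailE mxE. Qed.

Lemma map_intr_inj (R : numDomainType) m n :
  injective (fun M : 'M[int]_(m, n) => map_mx intr M : 'M[R]_(m, n)).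
Proof.
by move=> M N /matrixP e; apply/matrixP => i j; have := e i j; rewrite !mxE => /intr_inj.
Qed.

Variable R : realFieldType.

(** Take the least [m] for which [G m] has a nonzero vector [u], send [u] to a multiple of the first
    basis vector, and apply induction to the projections of the [G (k + 1)] along it. *)
Lemma adapted_basis n (G : nat -> set 'cV[int]_n) :
  (forall i j, (i <= j)%N -> G i `<=` G j) ->
  (forall k, (k < n)%N -> exists2 L : {vspace 'cV[R]_n}, (\dim L <= k)%N &
    forall z, G k z -> map_mx intr z \in L) ->
  exists2 U : 'M[int]_n, U \in unitmx & forall k z, G k z ->
    forall j : 'I_n, (k <= j)%N -> (U *m z) j 0 = 0.
Proof.
elim: n G => [|n IH] G mG dG.
  by exists 1%:M; [exact: unitmx1|move=> k z _ []].
have [exm|G0] := pselect (exists m, `[< (m < n.+1)%N /\ exists2 u, G m u & u != 0 >]);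
    last first.
  exists 1%:M; first exact: unitmx1.
  move=> k z Gz j kj; rewrite mul1mx.
  have -> : z = 0; last by rewrite mxE.
  apply/eqP; apply: contraT => z0; exfalso; apply: G0; exists k.
  apply/asboolP; by split; [exact: leq_ltn_trans kj _|exists z].
case: (ex_minnP exm) => m /asboolP[mn [u Gu u0]] mmin.
have [U1 uU1 [d U1u]] := unimodular_col u.
pose M : 'M[R]_(n, n.+1) := dsubmx (map_mx intr U1 : 'M[R]_(1 + n, n.+1)).
have ME z : M *m map_mx intr z = map_mx intr (vtail (U1 *m z)).
  by rewrite map_vtail map_mxM vtail_mulmx.
pose G' k := [set y | exists2 z, G k.+1 z & y = vtail (U1 *m z)].
have [|k kn|U' uU' hU'] := IH G'.
- by move=> i j ij _ [z Gz ->]; exists z => //; exact: mG Gz.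
- have [mk|km] := leqP m k.+1; last first.
    exists 0%VS => [|_ [z Gz ->]]; first by rewrite dimv0.
    rewrite (_ : z = 0) ?mulmx0 ?vtail0 ?map_mx0 ?mem0v//.
    apply/eqP; apply: contraT => z0; have : (m <= k.+1)%N.
      by apply: mmin; apply/asboolP; split; [exact: ltn_trans mn|exists z].
    by rewrite leqNgt km.
  have [L dL GL] := dG k.+1 kn.
  pose f : 'Hom('cV[R]_n.+1, 'cV[R]_n) := linfun (mulmx M).
  exists (f @: L)%VS; last first.
    by move=> _ [z Gz ->]; rewrite -ME -[M *m _](lfunE (mulmx M)) memv_img// GL.
  (* For [m <= k + 1] the vector [u] lies in [L] and is killed by the projection, so the dimension
     drops by at least one. *)
  have uL : map_mx intr u \in (L :&: lker f)%VS.
    rewrite memv_cap GL ?memv_ker ?lfunE/=; last exact: mG Gu.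
    by rewrite ME U1u vconsK map_mx0.
  have L0 : (0 < \dim (L :&: lker f))%N.
    rewrite lt0n dimv_eq0; apply: contraNneq u0 => L0.
    move: uL; rewrite L0 memv0 => /eqP e.
    by apply/eqP; apply: (@map_intr_inj R); rewrite e map_mx0.
  rewrite -ltnS (leq_trans _ dL)// -(limg_ker_dim f L).
  by rewrite -[X in (X < _)%N]add0n ltn_add2r.
exists ((block_mx 1%:M 0 0 U' : 'M[int]_(1 + n)) *m U1).
  by rewrite unitmx_mul uU1 andbT unitmxE (@det_ublock _ 1 n) det1 mul1r -unitmxE.
move=> k z Gz j kj; rewrite -mulmxA mul_block_vcons mul0mx [X in _ + X]mxE scaler0 !addr0 mul1r.
case: k => [|k] in Gz kj *.
  have [L dL GL] := dG 0%N isT.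
  have -> : z = 0; last first.
    rewrite mulmx0 vtail0 mulmx0.
    by case: (unliftP 0 j) => [i|] ->; rewrite ?vconsS ?vcons0 mxE.
  apply: (@map_intr_inj R); rewrite map_mx0; apply/eqP.
  by rewrite -memv0; move: dL; rewrite leqn0 dimv_eq0 => /eqP <-; exact: GL.
case: (unliftP 0 j) kj => [i|] -> // ki.
rewrite vconsS; apply: hU' ki; by exists z.
Qed.

End flag.

(** * Lower bound on the volume by successive projections *)

Section simplex_bound.
Context (R : realType).

Lemma norm_det_unimodular n (U : 'M[int]_n) : U \in unitmx ->
  `|\det (map_mx intr U : 'M[R]_n)| = 1.
Proof.
rewrite unitmxE det_map_mx => /orP[] /eqP ->; first by rewrite normr1.
by rewrite rmorphN1 normrN normr1.
Qed.

Lemma map_unimodular n (U : 'M[int]_n) : U \in unitmx ->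
  (map_mx intr U : 'M[R]_n) \in unitmx.
Proof.
by move=> uU; rewrite unitmxE unitfE -normr_eq0 norm_det_unimodular//.
Qed.

Lemma continuous_mulmx m n (M : 'M[R]_(m, n)) :
  continuous (mulmx M : 'cV[R]_n -> 'cV[R]_m).
Proof.
apply: continuous_col => i; under eq_fun do rewrite mxE.
apply: continuous_big => [|k _ x]; first exact: add_continuous.
exact: (cvgM (cvg_cst _) (@coord_continuous _ _ _ k 0 x)).
Qed.

Lemma compact_mulmx m n (M : 'M[R]_(m, n)) (K : set 'cV[R]_n) :
  compact K -> compact (mulmx M @` K).
Proof.
move=> cK; apply: continuous_compact => //; apply: continuous_subspaceT.
exact: continuous_mulmx.
Qed.

Lemma convex_mulmx m n (M : 'M[R]_(m, n)) (K : set 'cV[R]_n) :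
  convex K -> convex (mulmx M @` K).
Proof.
move=> cK _ _ s [x Kx <-] [y Ky <-] s01.
by exists (s *: x + (1 - s) *: y); rewrite ?mulmxDr -?scalemxAr//; exact: cK.
Qed.

Lemma vol_mulmx n (M : 'M[R]_n) (K : set 'cV[R]_n) : M \in unitmx ->
  vmeasurable K -> vol (mulmx M @` K) = (`|\det M|%:E * vol K)%E.
Proof.
move=> uM mK; have uV : invmx M \in unitmx by rewrite unitmx_inv.
have [_] := vscalesE (vscales_mulmx uV) mK.
rewrite det_inv normfV invrK => <-; congr vol; apply/seteqP; split => x.
  by move=> [y Ky <-]; rewrite /= mulKmx.
by move=> /= Kx; exists (invmx M *m x); rewrite ?mulKVmx.
Qed.

(* [hits B K r i] says that [r] satisfies the condition defining
   [packing_minimum K (lattice B) i] (see [packing_conditionE]). *)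
Definition hits n (B : 'M[R]_n) (K : set 'cV[R]_n) (r : R) (i : nat) :=
  forall L : {vspace 'cV[R]_n}, \dim L = (n - i)%N ->
  exists (z : 'cV[int]_n) a b l, [/\ K a, K b, l \in L,
    B *m map_mx intr z = r *: (a - b) + l & B *m map_mx intr z \notin L].

Lemma hits_mulmx n (M B : 'M[R]_n) (K : set 'cV[R]_n) r i :
  M \in unitmx -> hits B K r i -> hits (M *m B) (mulmx M @` K) r i.
Proof.
move=> uM hK L dL.
pose f : 'End('cV[R]_n) := linfun (mulmx (invmx M)).
have [|z [a [b [l [Ka Kb Ll zE zL]]]]] := hK (f @: L)%VS.
  rewrite limg_dim_eq//; apply/eqP; rewrite -subv0; apply/subvP => v.
  rewrite memv_cap memv_ker lfunE/= memv0 => /andP[_ /eqP /(congr1 (mulmx M))].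
  by rewrite mulKVmx// mulmx0 => ->.
have ML v : (M *m v \in L) = (v \in (f @: L)%VS).
  apply/idP/idP => [Lv|/memv_imgP[w Lw ->]].
    by rewrite -(mulKmx uM v) -[_ *m _](lfunE (mulmx (invmx M))) memv_img.
  by rewrite lfunE/= mulKVmx.
exists z, (M *m a), (M *m b), (M *m l); rewrite -mulmxA !ML; split => //.
  by rewrite zE mulmxDr -scalemxAr mulmxBr.
Qed.

Lemma hits_unimodular n (K : set 'cV[R]_n) r i (U : 'M[int]_n) :
  U \in unitmx -> hits 1%:M K r i ->
  hits 1%:M (mulmx (map_mx intr U) @` K) r i.
Proof.
move=> uU hK L dL; have uM := map_unimodular uU.
have [z [a [b [l]]]] := hits_mulmx uM hK dL.
by rewrite mulmx1 -map_mxM => zE; exists (U *m z), a, b, l; rewrite mul1mx.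
Qed.

(** A test space for the projection is replaced by its preimage, whose dimension is larger by one;
    since [i <= n], this is the codimension [i] required upstairs. This yields the comparison of
    packing minima under projection. *)
Lemma hits_vtail n (K : set 'cV[R]_n.+1) r i : (i <= n)%N ->
  hits 1%:M K r i -> hits 1%:M (@vtail R n @` K) r i.
Proof.
move=> in_ hK L dL.
pose M : 'M[R]_(n, n.+1) := dsubmx (1%:M : 'M[R]_(1 + n, n.+1)).
have ME x : M *m x = vtail x by rewrite -vtail_mulmx mul1mx.
pose f : 'Hom('cV[R]_n.+1, 'cV[R]_n) := linfun (mulmx M).
have fE x : f x = vtail x by rewrite lfunE/= ME.
have ff : limg f = fullv.
  apply/eqP; rewrite eqEsubv subvf/=; apply/subvP => y _.
  by rewrite -[y](vconsK 0) -fE memv_img// memvf.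
have [|z [a [b [l [Ka Kb Ll zE zL]]]]] := hK (f @^-1: L)%VS.
  rewrite -(limg_ker_dim f) lpreimK ?ff ?subvf//.
  rewrite (capv_idPr _); last first.
    by apply/subvP => v; rewrite memv_ker -memv_preim => /eqP ->; exact: mem0v.
  have := limg_ker_dim f fullv; rewrite capfv ff !dimvf /dim/= !muln1 dL.
  by move: in_; lia.
exists (vtail z), (vtail a), (vtail b), (vtail l); move: zE zL; rewrite !mul1mx => zE zL; split.
- by exists a.
- by exists b.
- by move: Ll; rewrite -memv_preim fE.
- by rewrite map_vtail zE vtailD vtailZ vtailB.
- by move: zL; rewrite -memv_preim fE map_vtail.
Qed.

Lemma convex_chord n (K : set 'cV[R]_n.+1) a b (e l : R) : convex K ->
  K a -> K b -> a - b = vcons e 0 -> 0 < l <= e ->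
  K (vcons (b 0 0) (vtail b)) /\ K (vcons (b 0 0 + l) (vtail b)).
Proof.
move=> cK Ka Kb ab /andP[l0 le]; rewrite vcons_eta; split=> //.
have e0 : 0 < e by exact: lt_le_trans le.
have := cK a b (l / e) Ka Kb.
rewrite divr_ge0 ?ler_pdivrMr ?mul1r ?le ?(ltW l0) ?(ltW e0)// => /(_ isT).
congr (K _); have -> : a = vcons e 0 + b by rewrite -ab subrK.
rewrite scalerDr -addrA -scalerDl [l / e + _]addrC subrK scale1r.
by rewrite -{1}(vcons_eta b) vconsZ vconsD scaler0 add0r addrC divfK// gt_eqF.
Qed.

(** Induction on the dimension: the condition of index [n + 1] supplies a chord for [vol_cone], and
    the others pass to the projection by [hits_vtail]. *)
Theorem simplex_volume_le n (K : set 'cV[R]_n) (s : nat -> R) :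
  compact K -> convex K -> K !=set0 -> (forall i, 0 < s i) ->
  (forall i, (0 < i <= n)%N -> hits 1%:M K (s i) i) ->
  ((n`!%:R^-1 * \prod_(1 <= i < n.+1) (s i)^-1)%:E <= vol K)%E.
Proof.
elim: n K => [|n IH] K cK cvK K0 s0 hK.
  (* In dimension 0 a nonempty set is the whole space, that is, the unit cube. *)
  rewrite big_nil invr1 mulr1.
  have <- : vol (@unit_cube R 0) = 1%E := (vol_unit_cube R 0).2.
  rewrite /vol (_ : Rn_col (n:=0) @^-1` K = Rn_col (n:=0) @^-1` @unit_cube R 0)//.
  case: K0 => x Kx; apply/seteqP; split => [[] _ []//|[] _ /=].
  by rewrite (_ : 0 = x)//; apply/colP => -[].
have [|z [a [b [l [Ka Kb]]]]] := hK n.+1 (leqnn _) 0%VS.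
  by rewrite dimv0 subnn.
rewrite mul1mx memv0 => /eqP ->; rewrite addr0 memv0 => zE z0.
have [U uU [d Uz]] := unimodular_col z.
have uM := map_unimodular uU; set M := map_mx intr U in uM.
set K' := mulmx M @` K.
have cK' : compact K' by exact: compact_mulmx.
have cvK' : convex K' by exact: convex_mulmx.
have -> : vol K = vol K'.
  rewrite vol_mulmx//; last exact: vmeasurable_compact.
  by rewrite norm_det_unimodular// mul1e.
have dE : s n.+1 *: (M *m a - M *m b) = vcons d%:~R 0.
  rewrite -mulmxBr scalemxAr -zE -map_mxM Uz.
  apply/colP => i; rewrite mxE.
  by case: (unliftP 0 i) => [k|] ->; rewrite ?vcons0 ?vconsS// !mxE.
have d0 : d != 0.
  apply: contraNneq z0 => d0; apply/eqP.
  have /(congr1 (mulmx (invmx U))) := Uz; rewrite mulKmx// d0.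
  rewrite (_ : vcons 0 0 = 0) ?mulmx0 => [->|]; first by rewrite map_mx0.
  by apply/colP => i; case: (unliftP 0 i) => [k|] ->; rewrite ?vcons0 ?vconsS !mxE.
have abE : M *m a - M *m b = vcons (d%:~R / s n.+1) 0.
  apply: (scalerI (lt0r_neq0 (s0 n.+1))).
  by rewrite dE vconsZ scaler0 mulrC divfK// lt0r_neq0.
have K'a : K' (M *m a) by exists a.
have K'b : K' (M *m b) by exists b.
have [t [p [Kt Ktl]]] : exists t p, K' (vcons t p) /\ K' (vcons (t + (s n.+1)^-1) p).
  (* The integer [d] is nonzero, so the chord has length at least [1 / s (n + 1)]; for negative [d]
     its ends are exchanged. *)
  have [dp|dn] := ltP 0 d.
    exists ((M *m b) 0 0), (vtail (M *m b)).
    apply: (convex_chord cvK' K'a K'b abE); rewrite invr_gt0 s0/=.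
    by rewrite ler_peMl ?invr_ge0 ?(ltW (s0 _))// ler1z.
  exists ((M *m a) 0 0), (vtail (M *m a)).
  apply: (@convex_chord _ _ _ _ (- (d%:~R / s n.+1)) _ cvK' K'b K'a).
    by rewrite -opprB abE -[in LHS]scaleN1r vconsZ scaler0 mulN1r.
  rewrite invr_gt0 s0/= -mulNr ler_peMl ?invr_ge0 ?(ltW (s0 _))//.
  by rewrite -intrN ler1z; move: d0 dn; lia.
apply: le_trans (vol_cone cK' cvK' _ Kt Ktl); last by rewrite invr_gt0.
have tK0 : (@vtail R n @` K') !=set0 by exists (vtail (M *m a)); exists (M *m a).
have hK' i : (0 < i <= n)%N -> hits 1%:M (@vtail R n @` K') (s i) i.
  move=> /andP[i0 in_]; apply: hits_vtail => //; apply: hits_unimodular => //.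
  by apply: hK; rewrite i0 leqW.
have := IH _ (compact_vtail cK') (convex_vtail cvK') tK0 s0 hK'.
have c0 : (0 <= ((s n.+1)^-1 / n.+1%:R)%:E)%E.
  by rewrite lee_fin divr_ge0// invr_ge0 ltW.
move=> /(lee_wpmul2l c0); apply: le_trans.
rewrite -EFinM lee_fin big_nat_recr//= factS natrM invfM.
rewrite le_eqVlt; apply/orP; left; apply/eqP; ring.
Qed.

End simplex_bound.

(** * Packing minima *)

Section power_limits.
Context (R : realType).

Lemma Bernoulli_1m n (d : R) : 0 <= d <= 1 -> 1 - n%:R * d <= (1 - d) ^+ n.
Proof.
move=> /andP[d0 d1]; elim: n => [|n IH]; first by rewrite mul0r subr0 expr0.
rewrite exprSr; apply: (@le_trans _ _ ((1 - n%:R * d) * (1 - d))).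
  have nd : 0 <= n%:R * d * d by rewrite !mulr_ge0.
  by rewrite -addn1 natrD; lra.
by rewrite ler_wpM2r// subr_ge0.
Qed.

(** This replaces the limit [t -> 1]. If [y < x], Bernoulli's inequality at [t = 1 - d], with
    [n * d * x] below [x - y], gives a contradiction. *)
Lemma le_of_powM n (x y : R) : 0 <= x ->
  (forall t, 0 < t < 1 -> t ^+ n * x <= y) -> x <= y.
Proof.
move=> x0 H; rewrite leNgt; apply/negP => yx.
(* Nonnegativity of [y] gives [x - y <= x], whence [d < 1]. *)
have y0 : 0 <= y.
  have h1 : 0 < (2^-1 : R) < 1 by apply/andP; split; lra.
  by apply: le_trans (H _ h1); rewrite mulr_ge0// exprn_ge0// invr_ge0.
have {}x0 : 0 < x by lra.
pose d := (x - y) / (2 * n.+1%:R * x).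
have den : 0 < 2 * n.+1%:R * x by rewrite !mulr_gt0.
have d0 : 0 < d by rewrite divr_gt0// subr_gt0.
have dx : d * (2 * n.+1%:R * x) = x - y by rewrite divfK// gt_eqF.
have n1 : 1 <= n.+1%:R :> R by rewrite ler1n.
have d1 : d < 1.
  rewrite /d ltr_pdivrMr// mul1r.
  have : x <= n.+1%:R * x by rewrite ler_peMl// ltW.
  lra.
have td : 0 < 1 - d < 1 by apply/andP; split; lra.
have := H _ td; apply/negP; rewrite -ltNge.
have d01 : 0 <= d <= 1 by apply/andP; split; exact: ltW.
apply: lt_le_trans (ler_wpM2r (ltW x0) (Bernoulli_1m n d01)).
have e1 : (1 - n%:R * d) * x = x - n%:R * (d * x) by ring.
have e2 : x - y = 2 * (n%:R * (d * x)) + 2 * (d * x).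
  by rewrite -dx -(natr1 n); ring.
have dx0 : 0 < d * x by exact: mulr_gt0.
have : 0 <= n%:R * (d * x) by rewrite mulr_ge0// ltW.
rewrite e1; lra.
Qed.

End power_limits.

Section packing_minima.
Context (R : realType).

(** As [K] is nonempty, [0] lies in [K - K] and one inclusion between the two sets always holds;
    they differ exactly when some lattice point of the left one is outside [L]. *)
Lemma packing_conditionE n (B : 'M[R]_n) (K : set 'cV[R]_n) r i : K !=set0 ->
  (forall L : {vspace 'cV[R]_n}, \dim L = (n - i)%N ->
    minkowski_sum (dilate r (difference_body K)) [set` L] `&` lattice B
      <> [set` L] `&` lattice B) <-> hits B K r i.
Proof.
move=> [c Kc]; split=> H L dL.
  apply: contrapT => nh; apply: (H L dL); apply/seteqP; split => x [Hx Bx]; split => //.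
    move: Bx Hx => [z _ <-] [_ [_ [a Ka [b Kb <-]] <-] [l Ll e]].
    apply: contrapT => /negP zL; apply: nh; exists z, a, b, l.
    by rewrite -e in zL *.
  exists 0; last by exists x => //; rewrite add0r.
  exists 0; last by rewrite scaler0.
  by exists c => //; exists c => //; rewrite subrr.
have [z [a [b [l [Ka Kb Ll zE]]]]] := H L dL.
move=> /negP zL e; apply: zL.
have : ([set` L] `&` lattice B) (B *m map_mx intr z); last by case.
rewrite -e; split; last by exists z.
exists (r *: (a - b)); last by exists l.
by exists (a - b) => //; exists a => //; exists b.
Qed.

Lemma packing_minimumE n (B : 'M[R]_n) (K : set 'cV[R]_n) i :
  B \in unitmx -> K !=set0 ->
  packing_minimum K (lattice B) i =
  inf [set r | 0 < r /\ hits 1%:M (mulmx (invmx B) @` K) r i].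
Proof.
move=> uB K0; rewrite /packing_minimum; congr inf; apply/seteqP.
have uV : invmx B \in unitmx by rewrite unitmx_inv.
split=> r [r0 H]; split => //.
  by rewrite -(mulVmx uB); apply: hits_mulmx => //; exact/packing_conditionE.
apply/packing_conditionE => //; rewrite -(mulmx1 B).
have -> : K = mulmx B @` (mulmx (invmx B) @` K); last exact: hits_mulmx.
apply/seteqP; split => x; last by move=> [_ [y Ky <-] <-]; rewrite mulKVmx.
by move=> Kx; exists (invmx B *m x); [exists x|rewrite mulKVmx].
Qed.

Variables (n : nat) (K : set 'cV[R]_n).
Hypotheses (cK : compact K) (cvK : convex K).

(** Moving [a] towards [b] by the ratio [r / r'] turns [r *: (a - b)] into [r' *: (a' - b)] with
    [a'] in [K]. *)
Lemma le_hits r r' i : 0 < r -> r <= r' -> hits 1%:M K r i -> hits 1%:M K r' i.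
Proof.
move=> r0 rr' hK L /hK [z [a [b [l [Ka Kb Ll zE zL]]]]].
have r'0 : 0 < r' by exact: lt_le_trans rr'.
exists z, ((r / r') *: a + (1 - r / r') *: b), b, l; split => //.
  by apply: cvK => //; rewrite divr_ge0 ?(ltW r0) ?(ltW r'0)//= ler_pdivrMr// mul1r.
rewrite zE; congr (_ + _); rewrite scalerBl scale1r addrA addrAC addrK -scalerBr scalerA.
by rewrite mulrC divfK// gt_eqF.
Qed.

(** Test against the kernel of the projection to the first [i] coordinates: for small [r], the first
    [i] coordinates of an integer vector in [r (K - K) + L] are integers of absolute value below
    1. *)
Lemma not_hits_small i : (i <= n)%N ->
  exists2 r0, 0 < r0 & forall r, 0 < r -> r <= r0 -> ~ hits 1%:M K r i.
Proof.
move=> in_.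
have [C C0 CK] : exists2 C, 0 < C & forall x (j : 'I_n), K x -> `|x j 0| <= C.
  have [M [_ MK]] := compact_bounded cK.
  exists (`|M| + 1) => [|x j Kx]; first by rewrite ltr_wpDl.
  apply: (le_trans _ (MK (`|M| + 1) _ x Kx)); last by rewrite ltr_pwDr// ler_norm.
  rewrite -[leRHS]/(mx_norm x) mx_normrE; exact: (le_bigmax _ (fun i => `|x i.1 i.2|) (j, 0)).
(* Coordinates of [a - b] are at most [2 * C] in absolute value, so after scaling they are at most
   [2 / 3]. *)
exists (3 * C)^-1; first by rewrite invr_gt0 mulr_gt0.
move=> r r0 rC hK.
pose f : 'Hom('cV[R]_n, 'cV[R]_i) := linfun (mulmx (pid_mx i)).
have fE x (j : 'I_n) (ji : (j < i)%N) : f x (Ordinal ji) 0 = x j 0.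
  rewrite lfunE/= mxE (bigD1 j)//= mxE eqxx ji mul1r big1 ?addr0// => k kj.
  by move: kj; rewrite -val_eqE eq_sym mxE/= => /negbTE ->; rewrite mul0r.
have ff : limg f = fullv.
  apply/eqP; rewrite eqEsubv subvf/=; apply/subvP => y _.
  have -> : y = f (pid_mx i *m y).
    rewrite lfunE/= mulmxA mul_pid_mx minnn (minn_idPr in_).
    by rewrite pid_mx_1 mul1mx.
  by rewrite memv_img// memvf.
have [|z [a [b [l [Ka Kb Ll]]]]] := hK (lker f).
  have := limg_ker_dim f fullv; rewrite capfv ff !dimvf /dim/= !muln1.
  by move/(congr1 (subn^~ i)); rewrite addnK.
rewrite mul1mx => zE; apply/negP; rewrite negbK memv_ker; apply/eqP/colP => -[j ji].
have jn : (j < n)%N by exact: leq_trans in_.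
have := fE (map_mx intr z) (Ordinal jn) ji => ->; rewrite mxE [RHS]mxE.
have /matrixP /(_ (Ordinal jn) 0) := zE.
have l0 : l (Ordinal jn) 0 = 0.
  move: Ll; rewrite memv_ker => /eqP /colP /(_ (Ordinal ji)).
  by have /= -> := fE l (Ordinal jn) ji; rewrite mxE.
rewrite !mxE l0 addr0 => e.
suff z1 : `|z (Ordinal jn) 0| < 1.
  by have -> : z (Ordinal jn) 0 = 0 by lia.
rewrite -(ltr_int R) intr_norm e normrM gtr0_norm//.
have Ca := CK _ (Ordinal jn) Ka; have Cb := CK _ (Ordinal jn) Kb.
apply: (@le_lt_trans _ _ ((3 * C)^-1 * (2 * C))).
  apply: ler_pM => //; first exact: ltW.
  by rewrite (le_trans (ler_normB _ _))// mulr_natl mulr2n lerD.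
by rewrite mulrC ltr_pdivrMr ?mulr_gt0// mul1r ltr_pM2r// ltr_nat.
Qed.

End packing_minima.

Section packing_minimum_threshold.
Context (R : realType).

(** Around an interior point [c], the body contains every [c + d *: col j B] for a small [d]. For
    [i > 0] the space [L] is proper, so it misses some column of [B], and [r = 1 / d] reaches that
    column. *)
Lemma hits_large n (B : 'M[R]_n) (K : set 'cV[R]_n) i : B \in unitmx ->
  interior K !=set0 -> (0 < i <= n)%N -> exists2 r, 0 < r & hits B K r i.
Proof.
move=> uB [c Kc] /andP[i0 in_].
have : \forall d \near nbhs (0 : R), forall j : 'I_n, K (c + d *: col j B).
  apply: (@filter_forall _ _ (fun j (d : R) => K (c + d *: col j B))) => j.
  have : {for 0, continuous (fun d : R => c + d *: col j B)}.
    by apply: cvgD; [exact: cvg_cst|apply: cvgZr_tmp; exact: cvg_id].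
  by apply; rewrite scale0r addr0.
move=> /nbhs_ballP[e /= e0 eK].
pose d := e / 2; have d0 : 0 < d by rewrite divr_gt0.
have dK j : K (c + d *: col j B).
  apply: eK; rewrite /ball/= sub0r normrN gtr0_norm// /d; lra.
exists d^-1; first by rewrite invr_gt0.
move=> L dL; have [j jL] : exists j, col j B \notin L.
  apply/existsP; rewrite -negb_forall; apply/negP => /forallP H.
  have : (\dim (fullv : {vspace 'cV[R]_n}) <= \dim L)%N.
    apply: dimvS; apply/subvP => y _; rewrite -(mulKVmx uB y).
    have -> : B *m (invmx B *m y) = \sum_j (invmx B *m y) j 0 *: col j B.
      apply/colP => k; rewrite mxE summxE; apply: eq_bigr => j _.
      by rewrite !mxE mulrC.
    by apply: memv_suml => j _; exact: memvZ.
  rewrite dimvf /dim/= muln1 dL; move: i0 in_; case: (n) => [|m]; first by case: (i).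
  by move=> i0 _; rewrite leqNgt ltn_subrL i0.
have Bj : B *m map_mx intr (delta_mx j 0 : 'cV[int]_n) = col j B.
  by rewrite colE; congr (_ *m _); apply/matrixP => k l; rewrite !mxE; case: (_ && _).
exists (delta_mx j 0), (c + d *: col j B), c, 0; split => //.
- exact: nbhs_singleton.
- exact: mem0v.
- by rewrite Bj addr0 addrAC subrr add0r scalerA mulVf ?gt_eqF// scale1r.
- by rewrite Bj.
Qed.

Variables (n : nat) (K : set 'cV[R]_n).
Hypotheses (cK : compact K) (cvK : convex K).
Let P i := [set r : R | 0 < r /\ hits 1%:M K r i].

Lemma inf_hits_gt0 i : (i <= n)%N -> P i !=set0 -> 0 < inf (P i).
Proof.
move=> in_ P0; have [r0 r00 nh] := not_hits_small cK in_.
apply: (lt_le_trans r00); apply: lb_le_inf => // r [rr0 hr].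
by rewrite leNgt; apply/negP => /ltW /(nh _ rr0).
Qed.

Lemma hits_gt_inf i r : P i !=set0 -> inf (P i) < r -> hits 1%:M K r i.
Proof.
move=> P0 ir; have Pinf : has_inf (P i).
  by split => //; exists 0 => s [/ltW].
have [|s [s0 hs] sr] := @inf_adherent _ _ (r - inf (P i)) _ Pinf.
  by rewrite subr_gt0.
by apply: (le_hits cvK s0) hs; rewrite addrC subrK in sr; exact: ltW.
Qed.

Lemma lt_inf_not_hits i r : 0 < r -> r < inf (P i) -> ~ hits 1%:M K r i.
Proof.
move=> r0 ri hr; have : inf (P i) <= r by apply: ge_inf => //; exists 0 => s [/ltW].
by rewrite leNgt ri.
Qed.

Theorem prod_inf_hits_ge : K !=set0 -> (forall i, (0 < i <= n)%N -> P i !=set0) ->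
  ((n`!%:R^-1 * \prod_(1 <= i < n.+1) (inf (P i))^-1)%:E <= vol K)%E.
Proof.
move=> K0 P0.
have rho0 i : (0 < i <= n)%N -> 0 < inf (P i).
  by move=> i0n; apply: inf_hits_gt0 (P0 _ i0n); case/andP: i0n.
set x := _ * _.
have x0 : 0 <= x.
  rewrite mulr_ge0 ?invr_ge0// big_seq prodr_ge0// => i.
  by rewrite mem_index_iota ltnS => /rho0 /ltW; rewrite invr_ge0.
have key t : 0 < t < 1 -> ((t ^+ n * x)%:E <= vol K)%E.
  (* Each [s i] lies strictly above the infimum, so its condition holds; the value 1 out of range
     only keeps [s] positive. *)
  move=> /andP[t0 t1]; pose s i := if (0 < i <= n)%N then t^-1 * inf (P i) else 1.
  have s0 i : 0 < s i.
    by rewrite /s; case: ifP => // i0n; rewrite mulr_gt0 ?invr_gt0// rho0.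
  have hs i : (0 < i <= n)%N -> hits 1%:M K (s i) i.
    move=> i0n; apply: hits_gt_inf; first exact: P0.
    by rewrite /s i0n ltr_pMl ?rho0// invf_gt1.
  have := simplex_volume_le cK cvK K0 s0 hs; congr (_%:E <= _)%E.
  rewrite /x mulrCA; congr (_ * _).
  rewrite (eq_big_nat _ _ (F2 := fun i => t * (inf (P i))^-1)); last first.
    by move=> i; rewrite ltnS => i0n; rewrite /s i0n invfM invrK.
  by rewrite big_split/= prodr_const_nat subn1.
case v : (vol K) key => [w| |] key; last 2 first.
- exact: leey.
- have h1 : 0 < (2^-1 : R) < 1 by apply/andP; split; lra.
  by have := key _ h1.
by rewrite lee_fin; apply: (@le_of_powM _ n) => // t /key; rewrite lee_fin.
Qed.

Lemma prod_rev (f : nat -> R) :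
  \prod_(j < n) f (n - j)%N = \prod_(1 <= i < n.+1) f i.
Proof.
rewrite big_add1 big_mkord (reindex_inj rev_ord_inj)/=.
by apply: eq_bigr => j _; congr f; have := ltn_ord j; lia.
Qed.

(** [f j] is the packing minimum of index [n - j], and [mu k] is the maximum of [f 0], ..., [f k].
    Below [mu k] all lattice points of the dilated difference body lie in a space of dimension at
    most [k], so [adapted_basis] and [packing_volume_le] apply. *)
Theorem prod_inf_hits_le : K !=set0 -> (forall i, (0 < i <= n)%N -> P i !=set0) ->
  (vol K <= (\prod_(1 <= i < n.+1) (inf (P i))^-1)%:E)%E.
Proof.
move=> K0 P0.
have rho0 i : (0 < i <= n)%N -> 0 < inf (P i).
  by move=> i0n; apply: inf_hits_gt0 (P0 _ i0n); case/andP: i0n.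
pose f j := if (j < n)%N then inf (P (n - j)%N) else 1.
have f0 j : 0 < f j.
  by rewrite /f; case: ifP => // jn; apply: rho0; rewrite subn_gt0 jn leq_subr.
pose mu := fix mu k := if k is k'.+1 then Num.max (mu k') (f k) else f 0%N.
have mu_mono : {homo mu : i j / (i <= j)%N >-> i <= j}.
  by apply: homo_leq => [//|x y z|k]; [exact: le_trans|rewrite /= le_max lexx].
have f_mu k : f k <= mu k by case: k => //= k; rewrite le_max lexx orbT.
have muE k : exists2 j, (j <= k)%N & mu k = f j.
  elim: k => [|k [j jk e]]; first by exists 0%N.
  rewrite /= /Num.max; case: ifP => _; last by exists j => //; exact: leqW.
  by exists k.+1.
have mu0 k : 0 < mu k by exact: lt_le_trans (f_mu k).
set p := \prod_(_ <= i < _) _.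
pose q := \prod_(1 <= i < n.+1) inf (P i).
have q0 : 0 < q.
  rewrite /q big_seq prodr_gt0// => i.
  by rewrite mem_index_iota ltnS => /rho0.
have key t : 0 < t < 1 -> ((t ^+ n * q)%:E * vol K <= 1)%E.
  move=> /andP[t0 t1]; pose r k := t * mu k.
  have r0 k : 0 < r k by rewrite mulr_gt0.
  have rm : {homo r : i j / (i <= j)%N >-> i <= j}.
    by move=> i j ij; rewrite ler_pM2l// mu_mono.
  pose G k := [set z : 'cV[int]_n | exists a b, [/\ K a, K b & map_mx intr z = r k *: (a - b)]].
  have [i j ij z [a [b [Ka Kb ze]]]|k kn|U uU hU] := @adapted_basis R n G.
  - exists ((r i / r j) *: a + (1 - r i / r j) *: b), b; split => //.
      by apply: cvK => //; rewrite divr_ge0 ?(ltW (r0 _))//= ler_pdivrMr// mul1r rm.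
    rewrite ze scalerBl scale1r addrA addrAC addrK -scalerBr scalerA.
    by rewrite mulrC divfK// gt_eqF.
  - have [j jk mukj] := muE k; have jn : (j < n)%N by exact: leq_ltn_trans kn.
    have rj : r k < inf (P (n - j)%N).
      have -> : inf (P (n - j)%N) = mu k by rewrite mukj /f jn.
      by rewrite gtr_pMl.
    (* [mu k] equals some [f j] with [j <= k]; failure of the condition of index [n - j] gives a
       space of dimension [j] containing [G k]. *)
    have /existsNP[L] := lt_inf_not_hits (r0 k) rj.
    move=> /not_implyP[dL nL]; exists L; first by rewrite dL subKn// ltnW.
    move=> z [a [b [Ka Kb ze]]]; apply: contrapT => /negP zL; apply: nL.
    by exists z, a, b, 0; rewrite mul1mx addr0; split => //; exact: mem0v.
  have uM : map_mx intr U \in @unitmx R n by exact: map_unimodular.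
  have -> : vol K = vol (mulmx (map_mx intr U) @` K).
    rewrite vol_mulmx//; last exact: vmeasurable_compact.
    by rewrite norm_det_unimodular// mul1e.
  have := @packing_volume_le _ _ (mulmx (map_mx intr U) @` K) r
    (compact_mulmx cK) (convex_mulmx cvK) (r0 0%N) rm.
  have hz (k : 'I_n) (z : 'cV[int]_n) a b :
      (mulmx (map_mx intr U) @` K) a -> (mulmx (map_mx intr U) @` K) b ->
      map_mx intr z = r k *: (a - b) -> forall j : 'I_n, (k <= j)%N -> z j 0 = 0.
    move=> [a' Ka <-] [b' Kb <-] ze j kj.
    rewrite -(mulKVmx uU z); apply: hU kj; exists a', b'; split => //.
    by rewrite map_mxM ze -scalemxAr -mulmxBr mulmxA -map_mxM mulVmx// map_mx1 mul1mx.
  move=> /(_ hz); apply: le_trans; apply: lee_wpmul2r; first exact: measure_ge0.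
  rewrite lee_fin /r big_split/= prodr_const card_ord ler_pM2l ?exprn_gt0//.
  (* The factors are compared through [f j <= mu j], the packing minima being taken in decreasing
     order of index. *)
  rewrite /q -prod_rev; apply: ler_prod => j _.
  rewrite (le_trans _ (f_mu j)) ?andbT; last by rewrite /f ltn_ord.
  by rewrite ltW// rho0// subn_gt0 ltn_ord leq_subr.
have pq : p = q^-1 by rewrite /p /q prodfV.
have h1 : 0 < (2^-1 : R) < 1 by apply/andP; split; lra.
case v : (vol K) key => [w| |] key.
- rewrite lee_fin pq -[leRHS]mul1r ler_pdivlMr//.
  have w0 : 0 <= w by rewrite -lee_fin -v; exact: measure_ge0.
  apply: (@le_of_powM _ n); first by rewrite mulr_ge0// ltW.
  by move=> t /key; rewrite -EFinM lee_fin [w * q]mulrC mulrA.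
- have := key _ h1; rewrite gt0_muley ?lte_fin ?mulr_gt0 ?exprn_gt0 ?invr_gt0//.
- by rewrite leNye.
Qed.

End packing_minimum_threshold.

Theorem theorem1p2 (R : realType) (n : nat) (K : set 'cV[R]_n) (B : 'M[R]_n)
    (hK : convex_body K) (hB : B \in unitmx) :
  (((n`!%:R^-1 * \prod_(1 <= i < n.+1) (packing_minimum K (lattice B) i)^-1)%:E
      <= vol K / (lattice_det B)%:E)
   /\ (vol K / (lattice_det B)%:E
      <= (\prod_(1 <= i < n.+1) (packing_minimum K (lattice B) i)^-1)%:E))%E.
Proof.
have [cK /convex_setE cvK iK] := hK.
have K0 : K !=set0 by case: iK => x Kx; exists x; exact: nbhs_singleton.
have uV : invmx B \in unitmx by rewrite unitmx_inv.
(* Passing to the inverse image of [K] under [B] turns the lattice into the integer lattice and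
   absorbs the division by the determinant. *)
set K1 := mulmx (invmx B) @` K.
have K10 : K1 !=set0 by case: K0 => x Kx; exists (invmx B *m x); exists x.
have -> : \prod_(1 <= i < n.+1) (packing_minimum K (lattice B) i)^-1 =
    \prod_(1 <= i < n.+1) (inf [set r | 0 < r /\ hits 1%:M K1 r i])^-1.
  by apply: eq_bigr => i _; rewrite packing_minimumE.
have -> : (vol K / (lattice_det B)%:E = vol K1)%E.
  rewrite vol_mulmx//; last exact: vmeasurable_compact.
  rewrite muleC /lattice_det det_inv normfV inver.
  have /negbTE dB : \det B != 0 by rewrite -unitfE -unitmxE.
  by rewrite normr_eq0 dB.
have P0 i : (0 < i <= n)%N -> [set r | 0 < r /\ hits 1%:M K1 r i] !=set0.
  move=> i0n; have [r r0 hr] := hits_large hB iK i0n.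
  by exists r; split => //; rewrite -(mulVmx hB); exact: hits_mulmx.
split.
- apply: prod_inf_hits_ge => //; [exact: compact_mulmx|exact: convex_mulmx].
- apply: prod_inf_hits_le => //; [exact: compact_mulmx|exact: convex_mulmx].
Qed.
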